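(* Let $X\subset\mathbb{R}^N$ be a closed semialgebraic set with $\dim X=n$, let $F=(f_1,\dots,f_m):X\to\mathbb{R}^m$ be a continuous semialgebraic mapping having a compact set of zeros, and let $n\le k\le m$. Then for any $L\in\mathbf{L}^{\mathbb{R}}(m,k)$ such that $(L\circ F)^{-1}(0)\cap X$ is compact, we have $$\mathcal{L}^{\mathbb{R}}_\infty(F|X)\ge\mathcal{L}^{\mathbb{R}}_\infty(L\circ F|X).$$ Moreover, for the generic $L\in\mathbf{L}^{\mathbb{R}}(m,k)$ the set $(L\circ F)^{-1}(0)$ is compact and $$\mathcal{L}^{\mathbb{R}}_\infty(F|X)=\mathcal{L}^{\mathbb{R}}_\infty(L\circ F|X).\qquad( * )$$ In particular, $( * )$ holds for the generic $L=(L_1,\dots,L_k)\in\Delta^{\mathbb{R}}(m,k)$, and moreover $\deg f_j=\deg(L_j\circ F)$ for $j=1,\dots,k$ for the generic such $L$, provided $f_1,\dots,f_m$ are polynomials with $\deg f_1\ge\dots\ge\deg f_m>0$.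
   Context: Dimension: $\dim X$ of a semialgebraic set $X\subset\mathbb{R}^N$ is the infimum of the dimensions of algebraic sets $V\subset\mathbb{R}^N$ with $X\subset V$. Linear mappings: $\mathbf{L}^{\mathbb{R}}(m,k)$ is the set of all linear mappings $\mathbb{R}^m\to\mathbb{R}^k$ (with $\mathbb{R}^0=\{0\}$). For $m\ge k$, $\Delta^{\mathbb{R}}(m,k)$ is the set of those $L=(L_1,\dots,L_k)\in\mathbf{L}^{\mathbb{R}}(m,k)$ of the form $L_i(y_1,\dots,y_m)=y_i+\sum_{j=k+1}^m\alpha_{i,j}y_j$, $i=1,\dots,k$, with $\alpha_{i,j}\in\mathbb{R}$. Generic: ''for the generic $x\in A$'' means that there exists an algebraic set $V$ such that $A\setminus V$ is a dense subset of $A$ and the property holds for all $x\in A\setminus V$. Łojasiewicz exponent at infinity: $\mathcal{L}^{\mathbb{R}}_\infty(G|X)$ is the supremum (in the extended reals) of the exponents $\nu$ for which there exist $C,R>0$ with $|G(x)|\ge C|x|^{\nu}$ for all $x\in X$, $|x|\ge R$. *)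

(* Defs.v *)
From HB Require Import structures.
From mathcomp Require Import all_boot all_order all_algebra.
From mathcomp Require Import all_classical all_reals all_analysis.
(* The notations of mpoly clash with those of analysis. *)
From mathcomp Require mpoly.
Import -(notations) mpoly.

Set Implicit Arguments.
Unset Strict Implicit.
Unset Printing Implicit Defensive.

Import Order.TTheory GRing.Theory Num.Theory numFieldNormedType.Exports.
Local Open Scope classical_set_scope.
Local Open Scope ring_scope.

Section Definitions.
Context {R : realType}.

Definition peval {N : nat} (p : mpoly N R) (x : 'rV[R]_N) : R := meval (x ord0) p.

(* Total degree; [msize p] is 1 + deg p for p != 0, and 0 for p = 0. *)
Definition mpdeg {N : nat} (p : mpoly N R) : nat := (mpoly.msize p).-1.

(* Euclidean norm; the library norm on 'rV[R]_n is the sup norm. *)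
Definition enorm {n : nat} (x : 'rV[R]_n) : R :=
  Num.sqrt (\sum_(i < n) x ord0 i ^+ 2).

Definition algebraic {N : nat} (V : set 'rV[R]_N) : Prop :=
  exists I : set (mpoly N R), V = [set x | forall p, I p -> peval p x = 0].

(* Finite unions of sets { p = 0 for all p in s, q > 0 for all q in t }. *)
Definition semialgebraic {N : nat} (X : set 'rV[R]_N) : Prop :=
  exists b : seq (seq (mpoly N R) * seq (mpoly N R)),
    X = [set x | exists2 st, st \in b &
           (forall p, p \in st.1 -> peval p x = 0) /\
           (forall q, q \in st.2 -> 0 < peval q x)].

(* A mapping defined on X is semialgebraic if its graph is; the values of F
   outside X are irrelevant. *)
Definition semialgebraic_map {N m : nat} (X : set 'rV[R]_N)
    (F : 'rV[R]_N -> 'rV[R]_m) : Prop :=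
  semialgebraic [set row_mx x (F x) | x in X].

Definition irreducible_algebraic {N : nat} (V : set 'rV[R]_N) : Prop :=
  [/\ algebraic V, V !=set0 &
      forall A B : set 'rV[R]_N, algebraic A -> algebraic B ->
        V = A `|` B -> V = A \/ V = B].

Definition irreducible_chain {N : nat} (V : set 'rV[R]_N) (d : nat) : Prop :=
  exists W : nat -> set 'rV[R]_N,
    (forall i, (i <= d)%N -> irreducible_algebraic (W i) /\ W i `<=` V) /\
    (forall i, (i < d)%N -> W i `<` W i.+1).

(* Krull dimension of an algebraic set; it is -oo for the empty set. *)
Definition alg_dim {N : nat} (V : set 'rV[R]_N) : \bar R :=
  ereal_sup [set (d%:R)%:E | d in irreducible_chain V].

Definition semialg_dim {N : nat} (X : set 'rV[R]_N) : \bar R :=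
  ereal_inf [set alg_dim V | V in [set V | algebraic V /\ X `<=` V]].

Definition zeros {N m : nat} (X : set 'rV[R]_N) (F : 'rV[R]_N -> 'rV[R]_m) :
    set 'rV[R]_N :=
  X `&` F @^-1` [set 0].

Definition loj_exp_infty {N m : nat} (X : set 'rV[R]_N)
    (G : 'rV[R]_N -> 'rV[R]_m) : \bar R :=
  ereal_sup [set nu%:E | nu in [set nu : R |
    exists C r : R, [/\ 0 < C, 0 < r &
      forall x, X x -> r <= enorm x -> C * (enorm x `^ nu) <= enorm (G x)]]].

(* A linear mapping R^m -> R^k is represented by a matrix L : 'M[R]_(m, k)
   acting on row vectors: y |-> y *m L, with i-th component column i of L. *)
Definition lin_comp {N m k : nat} (L : 'M[R]_(m, k))
    (F : 'rV[R]_N -> 'rV[R]_m) : 'rV[R]_N -> 'rV[R]_k :=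
  fun x => F x *m L.

Definition lin_comp_poly {N m k : nat} (L : 'M[R]_(m, k))
    (f : 'I_m -> mpoly N R) (j : 'I_k) : mpoly N R :=
  \sum_(i < m) L i j *: f i.

Definition Delta {m k : nat} (lekm : (k <= m)%N) : set 'M[R]_(m, k) :=
  [set L | exists alpha : 'I_k -> 'I_m -> R,
     forall (y : 'rV[R]_m) (i : 'I_k),
       (y *m L) ord0 i = y ord0 (widen_ord lekm i)
                         + \sum_(j < m | (k <= j)%N) alpha i j * y ord0 j].

(* Algebraic sets of matrices are those of R^(m * k) through mxvec. *)
Definition generically {m k : nat} (A : set 'M[R]_(m, k))
    (P : 'M[R]_(m, k) -> Prop) : Prop :=
  exists V : set 'rV[R]_(m * k),
    [/\ algebraic V,
        A `<=` closure (A `\` mxvec @^-1` V) &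
        forall L, (A `\` mxvec @^-1` V) L -> P L].

End Definitions.

(* Main.v *)
Require Import Defs.
From HB Require Import structures.
From mathcomp Require Import all_boot all_order all_algebra.
From mathcomp Require Import all_classical all_reals all_analysis.
From mathcomp Require mpoly.
Import -(notations) mpoly.
From mathcomp Require qe_rcf.
From mathcomp Require Import lra.
Import Order.TTheory GRing.Theory Num.Theory numFieldNormedType.Exports.
Local Open Scope classical_set_scope.
Local Open Scope ring_scope.

(* For L in M(m, k), call L bad if |F(x) L| is not bounded below by a multiple
   of |F(x)| as x in X tends to infinity; by compactness of the sphere, L then
   kills a limit y of the directions F(x) / |F(x)|. If L is not bad, then the
   zeros of L o F are bounded and |F| and |L o F| have the same growth.

   The set of bad L is semialgebraic by quantifier elimination, so it either
   has an interior or lies in a proper algebraic hypersurface. The interior is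
   empty for a reason of dimension:
   - X lies in an algebraic V without chains of irreducible sets of length
     k + 1, so the image of X under a semialgebraic map to R^(k+1) has empty
     interior. Indeed, after restricting to an irreducible component of V, the
     level sets of the first coordinate are not Zariski dense for all but
     finitely many levels, which allows an induction on k.
   - Hence any k polynomials g in y = F(x)/|F(x)| satisfy a nonzero relation
     P(t, g(y)) = 0 with t = 1/|x|^2. After division by a power of t, the
     relation P(0, g(y)) = 0 is nonzero and holds for the limits y: any k
     polynomials are dependent on the set of limits.
   - A chain of irreducible sets of length k yields k independent polynomials,
     so the Zariski closure T of the set of limits has no such chain. Generic
     linear forms cut the dimension of T down one by one: for L arbitrarily
     close to any given matrix, T meets the kernel of L in the empty set.

   For L in Delta, replace the equation p of the hypersurface by p(L A), where
   A is an invertible matrix for which this is not identically 0 on Delta. *)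

Set Implicit Arguments.
Unset Strict Implicit.
Unset Printing Implicit Defensive.

(** * Polynomial functions and polynomial maps *)

Section PolynomialFunctions.
Context {R : realType}.

Definition polyfun {N : nat} (f : 'rV[R]_N -> R) : Prop :=
  exists p : mpoly N R, f =1 peval p.

Definition polymap {N M : nat} (f : 'rV[R]_N -> 'rV[R]_M) : Prop :=
  forall i, polyfun (fun x => f x ord0 i).

Lemma eq_polyfun {N} (f g : 'rV[R]_N -> R) : f =1 g -> polyfun f -> polyfun g.
Proof. by move=> fg [p fp]; exists p => x; rewrite -fg. Qed.

Lemma polyfun_peval {N} (p : mpoly N R) : polyfun (peval p).
Proof. by exists p. Qed.

Lemma polyfun_cst {N} (c : R) : polyfun (fun _ : 'rV[R]_N => c).
Proof. by exists (mpolyC N c) => x; rewrite /peval mevalC. Qed.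

Lemma polyfun_coord {N} (i : 'I_N) : polyfun (fun x : 'rV[R]_N => x ord0 i).
Proof. by exists (mpolyX R (mnm1 i)) => x; rewrite /peval mevalXU. Qed.

Lemma polyfunD {N} (f g : 'rV[R]_N -> R) :
  polyfun f -> polyfun g -> polyfun (fun x => f x + g x).
Proof.
by move=> [p fp] [q gq]; exists (p + q) => x; rewrite fp gq /peval mevalD.
Qed.

Lemma polyfunM {N} (f g : 'rV[R]_N -> R) :
  polyfun f -> polyfun g -> polyfun (fun x => f x * g x).
Proof.
by move=> [p fp] [q gq]; exists (p * q) => x; rewrite fp gq /peval mevalM.
Qed.

Lemma polyfunN {N} (f : 'rV[R]_N -> R) : polyfun f -> polyfun (fun x => - f x).
Proof. by move=> [p fp]; exists (- p) => x; rewrite fp /peval mevalN. Qed.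

Lemma polyfunB {N} (f g : 'rV[R]_N -> R) :
  polyfun f -> polyfun g -> polyfun (fun x => f x - g x).
Proof. by move=> fp /polyfunN; exact: polyfunD. Qed.

Lemma polyfunX {N} (f : 'rV[R]_N -> R) k :
  polyfun f -> polyfun (fun x => f x ^+ k).
Proof.
move=> fp; elim: k => [|k IH]; first exact: polyfun_cst.
by apply: (eq_polyfun _ (polyfunM fp IH)) => x; rewrite exprS.
Qed.

Lemma polyfun_sum {N} (I : Type) (s : seq I) (P : pred I) (f : I -> 'rV[R]_N -> R) :
  (forall i, P i -> polyfun (f i)) -> polyfun (fun x => \sum_(i <- s | P i) f i x).
Proof.
move=> fp; elim: s => [|i s IH].
  by apply: (eq_polyfun _ (polyfun_cst 0)) => x; rewrite big_nil.
case Pi: (P i); last by apply: eq_polyfun IH => x; rewrite big_cons Pi.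
by apply: (eq_polyfun _ (polyfunD (fp i Pi) IH)) => x; rewrite big_cons Pi.
Qed.

Lemma polyfun_prod {N} (I : Type) (s : seq I) (P : pred I) (f : I -> 'rV[R]_N -> R) :
  (forall i, P i -> polyfun (f i)) -> polyfun (fun x => \prod_(i <- s | P i) f i x).
Proof.
move=> fp; elim: s => [|i s IH].
  by apply: (eq_polyfun _ (polyfun_cst 1)) => x; rewrite big_nil.
case Pi: (P i); last by apply: eq_polyfun IH => x; rewrite big_cons Pi.
by apply: (eq_polyfun _ (polyfunM (fp i Pi) IH)) => x; rewrite big_cons Pi.
Qed.

(** Follows from the expansion of a polynomial into monomials. It serves as an induction principle
    on functions, so that no later argument has to handle [mpoly] coefficients. *)
Lemma polyfun_rect {N} (Q : ('rV[R]_N -> R) -> Prop) :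
  (forall f g, f =1 g -> Q f -> Q g) ->
  (forall c, Q (fun=> c)) -> (forall i, Q (fun x => x ord0 i)) ->
  (forall f g, Q f -> Q g -> Q (fun x => f x + g x)) ->
  (forall f g, Q f -> Q g -> Q (fun x => f x * g x)) ->
  forall f, polyfun f -> Q f.
Proof.
move=> Qe Qc Qx QD QM f [p fp].
suff: Q (peval p) by apply: Qe => x; rewrite fp.
have Qprod (m : seq 'I_N) (h : 'I_N -> nat) :
    Q (fun x => \prod_(i <- m) x ord0 i ^+ h i).
  elim: m => [|i m IH]; first by apply: Qe (Qc 1) => x; rewrite big_nil.
  suff QXi: Q (fun x => x ord0 i ^+ h i).
    by apply: Qe (QM _ _ QXi IH) => x; rewrite big_cons.
  elim: (h i) => [|k IHk]; first exact: Qe (Qc 1).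
  by apply: Qe (QM _ _ (Qx i) IHk) => x; rewrite exprS.
apply: (@Qe (fun x => \sum_(m <- msupp p) mcoeff m p *
              \prod_(i <- index_enum 'I_N) x ord0 i ^+ (m i))).
  by move=> x; rewrite /peval mevalE.
elim: (msupp p : seq _) => [|m s IH].
  by apply: Qe (Qc 0) => x; rewrite big_nil.
apply: Qe (QD _ _ (QM _ _ (Qc (mcoeff m p)) (Qprod (index_enum 'I_N) m)) IH) => x.
by rewrite big_cons.
Qed.

Lemma polyfun_comp {N M} (f : 'rV[R]_M -> R) (g : 'rV[R]_N -> 'rV[R]_M) :
  polyfun f -> polymap g -> polyfun (f \o g).
Proof.
move=> fp gp; move: f fp; apply: polyfun_rect => //=.
- by move=> f h fh; apply: eq_polyfun => x /=; rewrite fh.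
- by move=> c; exact: polyfun_cst.
- by move=> f h; exact: polyfunD.
- by move=> f h; exact: polyfunM.
Qed.

Lemma polymap_comp {N M K} (f : 'rV[R]_M -> 'rV[R]_K) (g : 'rV[R]_N -> 'rV[R]_M) :
  polymap f -> polymap g -> polymap (f \o g).
Proof. by move=> fp gp i; exact: (polyfun_comp (fp i) gp). Qed.

Lemma polymap_id {N} : polymap (fun x : 'rV[R]_N => x).
Proof. exact: polyfun_coord. Qed.

Lemma polymap_cst {N M} (c : 'rV[R]_M) : polymap (fun _ : 'rV[R]_N => c).
Proof. by move=> i; exact: polyfun_cst. Qed.

Lemma polymap_lsub {K N M} (f : 'rV[R]_K -> 'rV[R]_(N + M)) :
  polymap f -> polymap (fun x => lsubmx (f x)).
Proof. by move=> fp i; apply: eq_polyfun (fp (lshift M i)) => x; rewrite mxE. Qed.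

Lemma polymap_rsub {K N M} (f : 'rV[R]_K -> 'rV[R]_(N + M)) :
  polymap f -> polymap (fun x => rsubmx (f x)).
Proof. by move=> fp i; apply: eq_polyfun (fp (rshift N i)) => x; rewrite mxE. Qed.

Lemma polymap_row {K N M} (f : 'rV[R]_K -> 'rV[R]_N) (g : 'rV[R]_K -> 'rV[R]_M) :
  polymap f -> polymap g -> polymap (fun x => row_mx (f x) (g x)).
Proof.
move=> fp gp i; rewrite -(splitK i); case: (fintype.split i) => j /=.
  by apply: eq_polyfun (fp j) => x; rewrite row_mxEl.
by apply: eq_polyfun (gp j) => x; rewrite row_mxEr.
Qed.

Lemma polymapD {K N} (f g : 'rV[R]_K -> 'rV[R]_N) :
  polymap f -> polymap g -> polymap (fun x => f x + g x).
Proof. by move=> fp gp i; apply: eq_polyfun (polyfunD (fp i) (gp i)) => x; rewrite !mxE. Qed.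

Lemma polymapN {K N} (f : 'rV[R]_K -> 'rV[R]_N) :
  polymap f -> polymap (fun x => - f x).
Proof. by move=> fp i; apply: eq_polyfun (polyfunN (fp i)) => x; rewrite !mxE. Qed.

Lemma polymapZ {K N} (c : 'rV[R]_K -> R) (f : 'rV[R]_K -> 'rV[R]_N) :
  polyfun c -> polymap f -> polymap (fun x => c x *: f x).
Proof. by move=> cp fp i; apply: eq_polyfun (polyfunM cp (fp i)) => x; rewrite !mxE. Qed.

Lemma polymap_lin {N M} (A : 'M[R]_(N, M)) : polymap (fun x => x *m A).
Proof.
move=> i; apply: (@eq_polyfun _ (fun x => \sum_j x ord0 j * A j i)).
  by move=> x; rewrite mxE.
apply: polyfun_sum => j _; apply: polyfunM; [exact: polyfun_coord|exact: polyfun_cst].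
Qed.

(* Unlike enorm, its square is polynomial. *)
Definition sqn {N} (x : 'rV[R]_N) : R := \sum_(i < N) x ord0 i ^+ 2.

Lemma sqn_ge0 {n} (x : 'rV[R]_n) : 0 <= sqn x.
Proof. by apply: sumr_ge0 => i _; exact: sqr_ge0. Qed.

Lemma sqn_eq0 {n} (x : 'rV[R]_n) : (sqn x == 0) = (x == 0).
Proof.
apply/idP/eqP => [|->]; last by rewrite /sqn big1// => i _; rewrite mxE expr0n.
rewrite psumr_eq0 => [/allP h|i _]; last exact: sqr_ge0.
apply/rowP => i; rewrite mxE; apply/eqP; rewrite -sqrf_eq0.
exact: h (mem_index_enum i).
Qed.

Lemma sqn0 {n} : sqn (0 : 'rV[R]_n) = 0.
Proof. by apply/eqP; rewrite sqn_eq0. Qed.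

Lemma sqn_gt0 {n} (x : 'rV[R]_n) : (0 < sqn x) = (x != 0).
Proof. by rewrite lt_def sqn_ge0 andbT sqn_eq0. Qed.

Lemma sqnZ {n} a (x : 'rV[R]_n) : sqn (a *: x) = a ^+ 2 * sqn x.
Proof. by rewrite /sqn mulr_sumr; apply: eq_bigr => i _; rewrite mxE exprMn. Qed.

Lemma polyfun_sqn {K N} (f : 'rV[R]_K -> 'rV[R]_N) :
  polymap f -> polyfun (fun x => sqn (f x)).
Proof. by move=> fp; apply: polyfun_sum => i _; exact: polyfunX. Qed.

(** This reduces statements about zeros in several variables to the finiteness of the roots of a
    polynomial in one variable. *)
Lemma polyfun_line {N} (f : 'rV[R]_N -> R) (x v : 'rV[R]_N) :
  polyfun f -> exists r : {poly R}, forall t, f (x + t *: v) = r.[t].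
Proof.
move=> fp; move: f fp; apply: polyfun_rect.
- by move=> f g fg [r fr]; exists r => t; rewrite -fg fr.
- by move=> c; exists c%:P => t; rewrite hornerC.
- move=> i; exists ((x ord0 i)%:P + (v ord0 i) *: 'X) => t.
  by rewrite !mxE hornerD hornerC hornerZ hornerX mulrC.
- by move=> f g [r fr] [s gs]; exists (r + s) => t; rewrite hornerD fr gs.
- by move=> f g [r fr] [s gs]; exists (r * s) => t; rewrite hornerM fr gs.
Qed.

(** The function is regarded as a polynomial in its first variable with polynomial coefficients in
    the others. *)
Lemma polyfun_split {d} (f : 'rV[R]_(1 + d) -> R) :
  polyfun f -> exists n (c : nat -> 'rV[R]_d -> R), (forall i, polyfun (c i)) /\
    forall (t : R) x, f (row_mx t%:M x) = \sum_(i < n) c i x * t ^+ i.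
Proof.
move=> fp.
suff [q fq]: exists q : {poly (mpoly d R)},
    forall (t : R) x, f (row_mx t%:M x) = \sum_(i < size q) peval q`_i x * t ^+ i.
  exists (size q), (fun i => peval q`_i); split=> [i|//]; exact: polyfun_peval.
pose ev (x : 'rV[R]_d) := map_poly (meval (x ord0)).
suff [q fq]: exists q : {poly (mpoly d R)},
    forall (t : R) x, f (row_mx t%:M x) = (ev x q).[t].
  exists q => t x; rewrite fq (@horner_coef_wide _ (size q)); last exact: size_poly.
  by apply: eq_bigr => i _; rewrite coef_map.
move: f fp; apply: polyfun_rect.
- by move=> f g fg [r fr]; exists r => t x; rewrite -fg fr.
- by move=> c; exists ((mpolyC d c)%:P) => t x; rewrite /ev map_polyC hornerC /= mevalC.
- move=> i; rewrite -(splitK i); case: (fintype.split i) => j /=.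
    exists 'X => t x; rewrite /ev map_polyX hornerX.
    by rewrite (row_mxEl (t%:M : 'M[R]_1) x ord0 j) !ord1 mxE eqxx mulr1n.
  exists ((mpolyX R (mnm1 j))%:P) => t x.
  rewrite /ev map_polyC hornerC /= mevalXU.
  by rewrite (row_mxEr (t%:M : 'M[R]_1) x ord0 j).
- by move=> f g [r fr] [s gs]; exists (r + s) => t x; rewrite /ev rmorphD hornerD fr gs.
- by move=> f g [r fr] [s gs]; exists (r * s) => t x; rewrite /ev rmorphM hornerM fr gs.
Qed.

Lemma polyfun_continuous {N} (f : 'rV[R]_N -> R) : polyfun f -> continuous f.
Proof.
move=> fp; move: f fp; apply: polyfun_rect.
- by move=> f g fg; rewrite (funext fg).
- by move=> c; exact: cst_continuous.
- by move=> i; exact: coord_continuous.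
- by move=> f g fc gc x; have fcx := fc x; have gcx := gc x; exact: continuousD.
- by move=> f g fc gc x; have fcx := fc x; have gcx := gc x; exact: continuousM.
Qed.

End PolynomialFunctions.

(** * Closure properties of semialgebraic sets; quantifier elimination *)

Section SemialgebraicSets.
Context {R : realType}.

Lemma eq_semialgebraic {N} (A B : set 'rV[R]_N) :
  (forall x, A x <-> B x) -> semialgebraic A -> semialgebraic B.
Proof. by move=> AB; have -> : A = B by apply/seteqP; split=> x /AB. Qed.

Definition basic_set {N} (st : seq (mpoly N R) * seq (mpoly N R)) : set 'rV[R]_N :=
  [set x | (forall p, p \in st.1 -> peval p x = 0) /\
           (forall q, q \in st.2 -> 0 < peval q x)].

Lemma semialgebraic_basic {N} (st : seq (mpoly N R) * seq (mpoly N R)) :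
  semialgebraic (basic_set st).
Proof.
exists [:: st]; apply/seteqP; split=> x /=; first by exists st; rewrite ?mem_head.
by move=> [st']; rewrite inE => /eqP ->.
Qed.

Lemma semialgebraic_set0 {N} : semialgebraic (set0 : set 'rV[R]_N).
Proof. by exists [::]; apply/seteqP; split=> x //= [st]. Qed.

Lemma semialgebraic_setT {N} : semialgebraic (setT : set 'rV[R]_N).
Proof. by apply: eq_semialgebraic (semialgebraic_basic ([::], [::])) => x; split. Qed.

Lemma semialgebraic_eq0 {N} (f : 'rV[R]_N -> R) :
  polyfun f -> semialgebraic [set x | f x = 0].
Proof.
move=> [p fp]; apply: eq_semialgebraic (semialgebraic_basic ([:: p], [::])) => x.
rewrite /basic_set /= fp; split=> [[h _]|px0]; first exact/h/mem_head.
by split=> // q; rewrite inE => /eqP ->.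
Qed.

Lemma semialgebraic_gt0 {N} (f : 'rV[R]_N -> R) :
  polyfun f -> semialgebraic [set x | 0 < f x].
Proof.
move=> [p fp]; apply: eq_semialgebraic (semialgebraic_basic ([::], [:: p])) => x.
rewrite /basic_set /= fp; split=> [[_ h]|px0]; first exact/h/mem_head.
by split=> // q; rewrite inE => /eqP ->.
Qed.

Lemma semialgebraicU {N} (A B : set 'rV[R]_N) :
  semialgebraic A -> semialgebraic B -> semialgebraic (A `|` B).
Proof.
move=> [a ->] [b ->]; exists (a ++ b); apply/seteqP; split=> x /=.
  by move=> [] [st sta h]; exists st; rewrite // mem_cat sta ?orbT.
by move=> [st]; rewrite mem_cat => /orP[sta|stb] h; [left|right]; exists st.
Qed.

Lemma semialgebraicI {N} (A B : set 'rV[R]_N) :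
  semialgebraic A -> semialgebraic B -> semialgebraic (A `&` B).
Proof.
move=> [a ->] [b ->].
exists [seq (s.1 ++ t.1, s.2 ++ t.2) | s <- a, t <- b].
apply/seteqP; split=> x /=.
  move=> [[s sa [s1 s2]] [t tb [t1 t2]]].
  exists (s.1 ++ t.1, s.2 ++ t.2); first by apply/allpairsP; exists (s, t).
  by split=> p /=; rewrite mem_cat => /orP[]; [exact: s1|exact: t1|exact: s2|exact: t2].
move=> [st /allpairsP[[s t] /= [sa tb ->]] /= [h1 h2]].
by split; [exists s|exists t] => //; split=> p ps; (apply: h1 || apply: h2);
  rewrite mem_cat ps ?orbT.
Qed.

(** Sets defined by one sign condition generate all others; the empty conjunction and the empty
    union are obtained as [0 < 1] and [0 < 0]. *)
Lemma semialgebraic_rect {N} (Q : set 'rV[R]_N -> Prop) :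
  (forall f, polyfun f -> Q [set x | f x = 0]) ->
  (forall f, polyfun f -> Q [set x | 0 < f x]) ->
  (forall A B, Q A -> Q B -> Q (A `|` B)) ->
  (forall A B, Q A -> Q B -> Q (A `&` B)) ->
  forall A, semialgebraic A -> Q A.
Proof.
move=> Qeq Qgt QU QI A [b ->].
have QT : Q setT.
  by have := Qgt _ (polyfun_cst 1); congr Q; apply/seteqP; split=> x _ //=.
have Q0 : Q set0.
  by have := Qgt _ (polyfun_cst 0); congr Q; apply/seteqP; split=> x //=; rewrite ltxx.
elim: b => [|st b IH].
  by move: Q0; congr Q; apply/seteqP; split=> x //= [].
have Qst : Q (basic_set st).
  have -> : basic_set st = [set x | forall p, p \in st.1 -> peval p x = 0] `&`
                          [set x | forall q, q \in st.2 -> 0 < peval q x] by [].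
  apply: (QI).
    elim: st.1 => [|p s IHs]; first by move: QT; congr Q; apply/seteqP; split.
    move: (QI _ _ (Qeq _ (polyfun_peval p)) IHs); congr Q.
    apply/seteqP; split=> x /=.
      by move=> [px0 h] q; rewrite inE => /orP[/eqP ->|/h].
    by move=> h; split=> [|q qs]; apply: h; rewrite inE ?eqxx ?qs ?orbT.
  elim: st.2 => [|p s IHs]; first by move: QT; congr Q; apply/seteqP; split.
  move: (QI _ _ (Qgt _ (polyfun_peval p)) IHs); congr Q.
  apply/seteqP; split=> x /=.
    by move=> [px0 h] q; rewrite inE => /orP[/eqP ->|/h].
  by move=> h; split=> [|q qs]; apply: h; rewrite inE ?eqxx ?qs ?orbT.
move: (QU _ _ Qst IH); congr Q; apply/seteqP; split=> x /=.
  move=> [h|[t tb h]]; first by exists st; rewrite ?mem_head.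
  by exists t; rewrite // inE tb orbT.
move=> [t]; rewrite inE => /orP[/eqP -> h|tb h]; first by left.
by right; exists t.
Qed.

Lemma semialgebraicC {N} (A : set 'rV[R]_N) : semialgebraic A -> semialgebraic (~` A).
Proof.
move: A; apply: semialgebraic_rect => [f fp|f fp|A B|A B].
- apply: eq_semialgebraic (semialgebraicU (semialgebraic_gt0 fp)
    (semialgebraic_gt0 (polyfunN fp))) => x /=; rewrite oppr_gt0.
  split=> [[|]|]; [by move/gt_eqF/eqP|by move/lt_eqF/eqP|].
  by move/eqP; rewrite neq_lt => /orP[]; [right|left].
- apply: eq_semialgebraic (semialgebraicU (semialgebraic_eq0 fp)
    (semialgebraic_gt0 (polyfunN fp))) => x /=; rewrite oppr_gt0.
  by split=> [[->|]|/negP]; rewrite ?ltxx// -?leNgt ?le_eqVlt;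
    [move=> h /lt_trans /(_ h); rewrite ltxx|case/orP => [/eqP|]; [left|right]].
- by move=> Ac Bc; rewrite setCU; exact: semialgebraicI.
- by move=> Ac Bc; rewrite setCI; exact: semialgebraicU.
Qed.

Lemma semialgebraic_ge0 {N} (f : 'rV[R]_N -> R) :
  polyfun f -> semialgebraic [set x | 0 <= f x].
Proof.
move=> /polyfunN /semialgebraic_gt0 /semialgebraicC.
apply: eq_semialgebraic => x /=; rewrite oppr_gt0.
by split=> [/negP|h]; rewrite ?leNgt//; apply/negP; rewrite -leNgt.
Qed.

Lemma semialgebraic_preimage {N M} (f : 'rV[R]_N -> 'rV[R]_M) (A : set 'rV[R]_M) :
  polymap f -> semialgebraic A -> semialgebraic [set x | A (f x)].
Proof.
move=> fp; move: A; apply: semialgebraic_rect => [g gp|g gp|A B|A B].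
- exact: (semialgebraic_eq0 (polyfun_comp gp fp)).
- exact: (semialgebraic_gt0 (polyfun_comp gp fp)).
- exact: semialgebraicU.
- exact: semialgebraicI.
Qed.

Lemma semialgebraic_eq {M K} (f g : 'rV[R]_M -> 'rV[R]_K) : polymap f -> polymap g ->
  semialgebraic [set z | f z = g z].
Proof.
move=> fp gp; apply: eq_semialgebraic (semialgebraic_eq0
  (polyfun_sqn (polymapD fp (polymapN gp)))) => z /=.
by split=> [/eqP|->]; [rewrite sqn_eq0 subr_eq0 => /eqP|apply/eqP; rewrite sqn_eq0 subrr].
Qed.

(** The valuation used for the formulas of [qe_rcf], whose variables are natural numbers; a variable
    numbered [N] or more reads the default value 0. *)
Definition env {N} (x : 'rV[R]_N) : seq R := [seq x ord0 i | i <- enum 'I_N].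

Lemma nth_env {N} (x : 'rV[R]_N) (i : 'I_N) : (env x)`_i = x ord0 i.
Proof. by rewrite (nth_map i) ?size_enum_ord// nth_ord_enum. Qed.

(** The last coordinate becomes the variable numbered [N], which is the one to be eliminated. *)
Lemma polyfun_term {N} (f : 'rV[R]_(N + 1) -> R) : polyfun f ->
  exists u : qe_rcf.term R, forall x (t : R),
    qe_rcf.eval (set_nth 0 (env x) N t) u = f (row_mx x t%:M).
Proof.
move: f; apply: polyfun_rect => [f g fg|c|i|f g|f g].
- by move=> [u fu]; exists u => x t; rewrite -fg.
- by exists (qe_rcf.Const c).
- rewrite -(splitK i); case: (fintype.split i) => j /=.
    exists (qe_rcf.Var R j) => x t; rewrite (row_mxEl x t%:M ord0 j) /=.
    by rewrite nth_set_nth /= ltn_eqF// nth_env.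
  exists (qe_rcf.Var R N) => x t; rewrite (row_mxEr x (t%:M : 'M[R]_1) ord0 j) /=.
  by rewrite nth_set_nth /= eqxx !ord1 mxE eqxx mulr1n.
- by move=> [u fu] [v gv]; exists (qe_rcf.Add u v) => x t; rewrite /= fu gv.
- by move=> [u fu] [v gv]; exists (qe_rcf.Mul u v) => x t; rewrite /= fu gv.
Qed.

Lemma polyfun_eval {N} (u : qe_rcf.term R) :
  polyfun (fun x : 'rV[R]_N => qe_rcf.eval (env x) u).
Proof.
elim: u => /=.
- move=> n; case: (ltnP n N) => nN.
    by apply: (eq_polyfun _ (polyfun_coord (Ordinal nN))) => x; rewrite -nth_env.
  apply: (eq_polyfun _ (polyfun_cst 0)) => x.
  by rewrite nth_default// size_map size_enum_ord.
- exact: polyfun_cst.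
- by move=> n; exact: polyfun_cst.
- by move=> u pu v pv; exact: polyfunD.
- by move=> u pu; exact: polyfunN.
- move=> u pu n; apply: (eq_polyfun _ (polyfunM pu (polyfun_cst n%:R))) => x.
  by rewrite mulr_natr.
- by move=> u pu v pv; exact: polyfunM.
- by move=> u pu n; exact: polyfunX.
Qed.

Lemma semialgebraic_qf_eval {N} (f : qe_rcf.formula R) :
  semialgebraic [set x : 'rV[R]_N | qe_rcf.qf_eval (env x) f].
Proof.
elim: f => /=.
- by case; [apply: eq_semialgebraic semialgebraic_setT|apply: eq_semialgebraic semialgebraic_set0].
- move=> u v; apply: eq_semialgebraic
    (semialgebraic_eq0 (polyfunB (polyfun_eval u) (polyfun_eval v))) => x /=.
  by rewrite -subr_eq0; split=> /eqP.
- move=> u v; apply: eq_semialgebraic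
    (semialgebraic_gt0 (polyfunB (polyfun_eval v) (polyfun_eval u))) => x /=.
  by rewrite subr_gt0.
- move=> u v; apply: eq_semialgebraic
    (semialgebraic_ge0 (polyfunB (polyfun_eval v) (polyfun_eval u))) => x /=.
  by rewrite subr_ge0.
- move=> f fs g gs; apply: eq_semialgebraic (semialgebraicI fs gs) => x /=.
  by split=> /andP.
- move=> f fs g gs; apply: eq_semialgebraic (semialgebraicU fs gs) => x /=.
  by split=> /orP.
- move=> f fs g gs; apply: eq_semialgebraic (semialgebraicU (semialgebraicC fs) gs) => x /=.
  by split=> [[/negP/negbTE ->|->]|]; rewrite ?implybT// implybE => /orP[/negP|]; [left|right].
- by move=> f fs; apply: eq_semialgebraic (semialgebraicC fs) => x /=; split=> /negP.
Qed.

(* The quantifier elimination of qe_rcf reduces the existence of y to a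
   quantifier-free formula in the entries of x. *)
Lemma semialgebraic_proj1 {N} (A : set 'rV[R]_(N + 1)) :
  semialgebraic A -> semialgebraic [set x | exists y : 'rV[R]_1, A (row_mx x y)].
Proof.
move=> [b ->]; elim: b => [|[ps qs] b IH].
  by apply: eq_semialgebraic semialgebraic_set0 => x; split=> // -[y [st]].
have term_of p : {u : qe_rcf.term R | forall (x : 'rV[R]_N) (t : R),
    qe_rcf.eval (set_nth 0 (env x) N t) u = peval p (row_mx x t%:M)}.
  by apply: cid; apply: polyfun_term; exact: polyfun_peval.
(* [absr p] is [p] as a polynomial in the variable [N] with terms as coefficients; [CcountGt0] then
   expresses that the first list has a common root at which the second list is positive. *)
pose absr p := qe_rcf.abstrX N (sval (term_of p)).
have absrE x t p : (qe_rcf.eval_poly (env x) (absr p)).[t] = peval p (row_mx x t%:M).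
  by rewrite qe_rcf.abstrXP; exact: svalP (term_of p) x t.
have h := semialgebraic_qf_eval (N := N) (qe_rcf.CcountGt0 (map absr ps) (map absr qs)).
apply: eq_semialgebraic (semialgebraicU h IH) => x /=; rewrite qe_rcf.eval_CcountGt0.
split=> [[/qe_rcf_th.ccount_gt0P|]|].
- move=> [t]; rewrite !big_all !all_map => /andP[/allP h1 /allP h2].
  exists t%:M, (ps, qs); first exact: mem_head.
  by split=> [p /h1|p /h2] /=; rewrite absrE // => /eqP.
- by move=> [y [st stb h']]; exists y, st; rewrite // inE stb orbT.
- move=> [y [st]]; rewrite inE => /orP[/eqP ->|stb h'] /=; last first.
    by right; exists y, st.
  rewrite (mx11_scalar y) => -[h1 h2]; left; apply/qe_rcf_th.ccount_gt0P.
  exists (y 0 0); rewrite !big_all !all_map; apply/andP; split.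
    by apply/allP => p /h1 /eqP; rewrite /= absrE.
  by apply/allP => p /h2; rewrite /= absrE.
Qed.

(** Induction on [M]: the first coordinate of [y] is attached to [x], the induction hypothesis
    eliminates the others, and [semialgebraic_proj1] eliminates the first. *)
Lemma semialgebraic_ex {N M} (P : 'rV[R]_N -> 'rV[R]_M -> Prop) :
  semialgebraic [set z | P (lsubmx z) (rsubmx z)] ->
  semialgebraic [set x | exists y, P x y].
Proof.
elim: M N P => [|M IH] N P sP.
  have : polymap (fun x : 'rV[R]_N => row_mx x (0 : 'rV[R]_0)).
    by apply: polymap_row; [exact: polymap_id|exact: polymap_cst].
  move=> /semialgebraic_preimage /(_ sP); apply: eq_semialgebraic => x /=.
  rewrite row_mxKl row_mxKr; split=> [Px|[y]]; first by exists 0.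
  by rewrite (thinmx0 y).
pose P' (xt : 'rV[R]_(N + 1)) (y : 'rV[R]_M) :=
  P (lsubmx xt) (row_mx (rsubmx xt) y : 'rV[R]_(1 + M)).
have sP' : semialgebraic [set z | P' (lsubmx z) (rsubmx z)].
  have : polymap (fun z : 'rV[R]_(N + 1 + M) => row_mx (lsubmx (lsubmx z))
      (row_mx (rsubmx (lsubmx z)) (rsubmx z) : 'rV[R]_(1 + M)) : 'rV[R]_(N + (1 + M))).
    apply: polymap_row; first exact/polymap_lsub/polymap_lsub/polymap_id.
    apply: polymap_row; first exact/polymap_rsub/polymap_lsub/polymap_id.
    exact/polymap_rsub/polymap_id.
  move=> /semialgebraic_preimage /(_ sP); apply: eq_semialgebraic => x /=.
  by rewrite row_mxKl row_mxKr.
have := semialgebraic_proj1 (IH _ _ sP'); apply: eq_semialgebraic => x /=.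
split=> [[t [y]]|[y]].
  by rewrite /P' row_mxKl row_mxKr => Pxy; eexists; exact: Pxy.
rewrite -(@hsubmxK _ 1 1 M y) => Pxy; exists (@lsubmx _ 1 1 M y), (@rsubmx _ 1 1 M y).
by rewrite /P' row_mxKl row_mxKr.
Qed.

Lemma semialgebraic_all {N M} (P : 'rV[R]_N -> 'rV[R]_M -> Prop) :
  semialgebraic [set z | P (lsubmx z) (rsubmx z)] ->
  semialgebraic [set x | forall y, P x y].
Proof.
move=> /semialgebraicC sP.
have /semialgebraicC := @semialgebraic_ex N M (fun x y => ~ P x y) sP.
apply: eq_semialgebraic => x /=; split=> [/forallNP h y|h [y]]; last exact.
exact: contrapT (h y).
Qed.

End SemialgebraicSets.

(** * Thin sets: the subsets of proper algebraic hypersurfaces *)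

Section ThinSets.
Context {R : realType}.

Lemma poly_nonroot (r : {poly R}) (a b : R) :
  r != 0 -> a < b -> exists2 t, a < t < b & r.[t] != 0.
Proof.
move=> r0 ab; apply: contrapT => h.
(* These are distinct points strictly between [a] and [b], and [size r] of them are more than [r]
   can have as roots. *)
pose u i := a + (b - a) / i.+2%:R.
have b_a : 0 < b - a by rewrite subr_gt0.
have u_in i : a < u i < b.
  rewrite /u ltrDl divr_gt0 ?ltr0n//= -ltrBrDl ltr_pdivrMr ?ltr0n//.
  by rewrite ltr_pMr// ltr1n.
have us : uniq [seq u i | i <- iota 0 (size r)].
  rewrite map_inj_uniq ?iota_uniq// => i j /addrI /(mulfI (lt0r_neq0 b_a)).
  by move=> /invr_inj /eqP; rewrite eqr_nat => /eqP[].
have rs : all (root r) [seq u i | i <- iota 0 (size r)].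
  apply/allP => _ /mapP[i _ ->]; apply: contrapT => /negP nr.
  by apply: h; exists (u i).
by have := max_poly_roots r0 rs us; rewrite size_map size_iota ltnn.
Qed.

(* Polynomials are nonzero when they are so as functions, R being infinite. *)
Definition thin {N} (A : set 'rV[R]_N) : Prop :=
  exists f, [/\ polyfun f, exists x, f x != 0 & forall x, A x -> f x = 0].

Definition box {N} (x : 'rV[R]_N) (e : R) : set 'rV[R]_N :=
  [set y | forall i, `|y ord0 i - x ord0 i| < e].

(** These are the affine subspaces, possibly empty. Arguing relative to such a [D] covers at once
    the space of all matrices and [Delta]. *)
Definition line_closed {N} (D : set 'rV[R]_N) : Prop :=
  forall x y t, D x -> D y -> D (x + t *: (y - x)).

(** On the line through a point where [f] is nonzero and a point where [g] is nonzero, both restrict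
    to nonzero polynomials in one variable, and so does their product. *)
Lemma polyfun_mul_neq0 {N} (D : set 'rV[R]_N) (f g : 'rV[R]_N -> R) :
  line_closed D -> polyfun f -> polyfun g ->
  (exists2 x, D x & f x != 0) -> (exists2 x, D x & g x != 0) ->
  exists2 x, D x & f x * g x != 0.
Proof.
move=> Dl fp gp [x Dx fx] [y Dy gy].
have [r fr] := polyfun_line x (y - x) fp; have [s gs] := polyfun_line x (y - x) gp.
have r0 : r != 0.
  by apply: contraNneq fx => r0; have := fr 0; rewrite r0 horner0 scale0r addr0 => ->.
have s0 : s != 0.
  apply: contraNneq gy => s0; have := gs 1.
  by rewrite s0 horner0 scale1r addrC subrK => ->.
have [t _ ht] := poly_nonroot (mulf_neq0 r0 s0) ltr01.
by exists (x + t *: (y - x)); [exact: Dl|rewrite fr gs -hornerM].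
Qed.

Lemma polyfun_prod_neq0 {N} (D : set 'rV[R]_N) (I : eqType) (s : seq I)
    (f : I -> 'rV[R]_N -> R) :
  line_closed D -> D !=set0 -> (forall i, polyfun (f i)) ->
  (forall i, i \in s -> exists2 x, D x & f i x != 0) ->
  exists2 x, D x & \prod_(i <- s) f i x != 0.
Proof.
move=> Dl [x0 Dx0] fp; elim: s => [_|i s IH f0].
  by exists x0; rewrite ?big_nil ?oner_neq0.
have prodp : polyfun (fun x => \prod_(j <- s) f j x) by exact: polyfun_prod.
have [|x Dx fx] := polyfun_mul_neq0 Dl (fp i) prodp (f0 i (mem_head _ _)).
  by apply: IH => j js; apply: f0; rewrite inE js orbT.
by exists x => //; rewrite big_cons.
Qed.

Lemma line_closedT {N} : line_closed (setT : set 'rV[R]_N).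
Proof. by []. Qed.

(** On the line from [x] to a point where [f] is nonzero, [f] has finitely many zeros, so points
    near [x] avoid them. *)
Lemma polyfun_neq0_box {N} (D : set 'rV[R]_N) (f : 'rV[R]_N -> R) x e :
  line_closed D -> polyfun f -> (exists2 y, D y & f y != 0) -> D x -> 0 < e ->
  exists2 y, D y /\ box x e y & f y != 0.
Proof.
move=> Dl fp [y Dy fy] Dx e0.
have [r fr] := polyfun_line x (y - x) fp.
have r0 : r != 0.
  apply: contraNneq fy => r0; have := fr 1.
  by rewrite r0 horner0 scale1r addrC subrK => ->.
(* [M] bounds every coordinate of [y - x], so that [t < e / M] keeps the point in the box. *)
pose M := 1 + \sum_i `|(y - x) ord0 i|.
have M0 : 0 < M by rewrite ltr_pwDl// sumr_ge0.
have [t /andP[t0 te] rt] := poly_nonroot r0 (divr_gt0 e0 M0).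
exists (x + t *: (y - x)); last by rewrite fr.
split; first exact: Dl.
move=> i; have -> : (x + t *: (y - x)) ord0 i - x ord0 i = t * (y - x) ord0 i.
  by rewrite !mxE addrC addKr.
rewrite normrM gtr0_norm//.
move: te; rewrite ltr_pdivlMr//; apply: le_lt_trans.
rewrite ler_pM2l// /M (bigD1 i)//= addrCA lerDl addr_ge0// sumr_ge0// => j _.
Qed.

Lemma box_not_thin {N} (x : 'rV[R]_N) e : 0 < e -> ~ thin (box x e).
Proof.
move=> e0 [f [fp [y fy] fbox]].
have [|z [_ /fbox ->]] := polyfun_neq0_box (x := x) line_closedT fp _ I e0.
  by exists y.
by rewrite eqxx.
Qed.

Lemma box_row_mx {N M} (x y : 'rV[R]_N) (x' y' : 'rV[R]_M) e :
  box x e y -> box x' e y' -> box (row_mx x x') e (row_mx y y').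
Proof.
move=> xy xy' i; rewrite -(splitK i); case: (fintype.split i) => j /=.
  by rewrite (row_mxEl y y' ord0 j) (row_mxEl x x' ord0 j).
by rewrite (row_mxEr y y' ord0 j) (row_mxEr x x' ord0 j).
Qed.

Lemma sub_thin {N} (A B : set 'rV[R]_N) : A `<=` B -> thin B -> thin A.
Proof. by move=> AB [f [fp f0 fB]]; exists f; split=> // x /AB /fB. Qed.

Lemma thinU {N} (A B : set 'rV[R]_N) : thin A -> thin B -> thin (A `|` B).
Proof.
move=> [f [fp [x fx] fA]] [g [gp [y gy] gB]].
have [||z _ fgz] := polyfun_mul_neq0 line_closedT fp gp; [by exists x|by exists y|].
exists (fun x => f x * g x); split; [exact: polyfunM|by exists z|].
by move=> u [/fA ->|/gB ->]; rewrite ?mul0r ?mulr0.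
Qed.

Lemma thin0 {N} : thin (set0 : set 'rV[R]_N).
Proof. by exists (fun=> 1); split=> //; [exact: polyfun_cst|exists 0; rewrite oner_neq0]. Qed.

Lemma thin_bigU {N} (I : eqType) (s : seq I) (A : I -> set 'rV[R]_N) :
  (forall i, i \in s -> thin (A i)) -> thin [set x | exists2 i, i \in s & A i x].
Proof.
elim: s => [|i s IH] h; first by apply: sub_thin thin0 => x [].
have hs j : j \in s -> thin (A j) by move=> js; apply: h; rewrite inE js orbT.
apply: sub_thin (thinU (h i (mem_head _ _)) (IH hs)) => x [j].
by rewrite inE => /orP[/eqP ->|js Aj]; [left|right; exists j].
Qed.

Lemma nbhs_entrywise {m n} (x : 'M[R]_(m, n)) (B : set 'M[R]_(m, n)) :
  nbhs x B -> exists2 e, 0 < e & forall y : 'M[R]_(m, n), (forall i j, `|y i j - x i j| < e) -> B y.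
Proof.
move=> /nbhs_ballP[e /= e0 he]; exists e => // y xy; apply: he.
by split=> // i j; rewrite /ball /= distrC.
Qed.

Lemma polyfun_gt0_box {N} (f : 'rV[R]_N -> R) x :
  polyfun f -> 0 < f x -> exists2 e, 0 < e & forall y, box x e y -> 0 < f y.
Proof.
move=> fp fx0.
have /polyfun_continuous /(_ x [set z | 0 < z]) := fp.
have /[swap]/[apply] : nbhs (f x) [set z | 0 < z].
  by apply: open_nbhs_nbhs; split=> //; exact: open_gt.
move=> /nbhs_entrywise[e e0 he]; exists e => // y xy; apply: he => i j.
by rewrite (ord1 i); exact: xy.
Qed.

Lemma polyfun_gt0_box_seq {N} (s : seq (mpoly N R)) x :
  (forall q, q \in s -> 0 < peval q x) -> exists2 e, 0 < e &
  forall y, box x e y -> forall q, q \in s -> 0 < peval q y.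
Proof.
elim: s => [|q s IH] h; first by exists 1.
have [e1 e10 h1] := polyfun_gt0_box (polyfun_peval q) (h q (mem_head _ _)).
have [|e2 e20 h2] := IH; first by move=> p ps; apply: h; rewrite inE ps orbT.
exists (Num.min e1 e2); first by rewrite lt_min e10.
move=> y xy p; rewrite inE => /orP[/eqP ->|ps].
  by apply: h1 => i; apply: lt_le_trans (xy i) _; rewrite ge_min lexx.
by apply: h2 ps => i; apply: lt_le_trans (xy i) _; rewrite ge_min lexx orbT.
Qed.

(** Some basic piece is not thin. Its equations must then vanish identically, so this piece is given
    by strict inequalities alone and is open. *)
Lemma semialgebraic_not_thin {N} (A : set 'rV[R]_N) : semialgebraic A -> ~ thin A ->
  exists x e, 0 < e /\ box x e `<=` A.
Proof.
move=> [b Ab] nA.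
have [st stb nst] : exists2 st, st \in b & ~ thin (basic_set st).
  apply: contrapT => h; apply: nA; rewrite Ab.
  by apply: (thin_bigU (A := basic_set)) => st stb; apply: contrapT => nst; apply: h; exists st.
have [x [h1 h2]] : exists x, basic_set st x.
  by apply: contrapT => h; apply: nst; apply: sub_thin thin0 => x xs; apply: h; exists x.
have [e e0 he] := polyfun_gt0_box_seq h2.
exists x, e; split=> // y xy; rewrite Ab; exists st => //; split=> [p ps|]; last exact: he.
apply: contrapT => /eqP py; apply: nst; exists (peval p); split.
- exact: polyfun_peval.
- by exists y.
- by move=> z [hz _]; exact: hz.
Qed.

End ThinSets.

(** * Dickson's lemma on sequences of exponents *)

Section Dickson.

(** Beyond any index there is one where [f] is least on the remaining tail; visiting such indices in
    succession gives the subsequence. *)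
Lemma nondecreasing_subseq (f : nat -> nat) : exists phi : nat -> nat,
  {homo phi : i j / (i < j)%N} /\ {homo f \o phi : i j / (i <= j)%N}.
Proof.
have least k : exists j, (k <= j)%N /\ forall i, (k <= i)%N -> (f j <= f i)%N.
  have ex : exists v, `[< exists j, (k <= j)%N /\ f j = v >].
    by exists (f k); apply/asboolP; exists k.
  by case: (ex_minnP ex) => v /asboolP[j [kj fj]] h; exists j; split=> // i ki;
    rewrite fj; apply: h; apply/asboolP; exists i.
have [g gP] := choice least.
pose phi := fix phi i := if i is i'.+1 then g (phi i').+1 else g 0%N.
have phiS i : (phi i < phi i.+1)%N by have [] := gP (phi i).+1.
exists phi; split; first by apply: homo_ltn => // j i k; exact: ltn_trans.
apply: (@homo_leq _ (f \o phi) (fun a b => (a <= b)%N)) => [//|j i k|i].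
  exact: leq_trans.
rewrite /=; case: i => [|i] /=; first exact: (gP 0%N).2.
by apply: (gP (phi i).+1).2; exact: leq_trans (phiS i) (ltnW (phiS i.+1)).
Qed.

(** Subsequences are extracted for one coordinate after the other; the first two terms of the last
    one are comparable in all coordinates. *)
Lemma dickson n (u : nat -> multinom n) :
  exists i j, (i < j)%N /\ forall l, (u i l <= u j l)%N.
Proof.
suff [phi [phi_incr h]] : exists phi : nat -> nat, {homo phi : i j / (i < j)%N} /\
    forall l, l \in enum 'I_n -> {homo (fun i => u (phi i) l) : i j / (i <= j)%N}.
  exists (phi 0%N), (phi 1%N); split; first exact: phi_incr.
  by move=> l; have := h l; rewrite mem_enum => /(_ isT 0%N 1%N isT).
elim: (enum 'I_n) => [|l s [phi [phi_incr h]]]; first by exists id; split.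
have [psi [psi_incr hpsi]] := nondecreasing_subseq (fun i => u (phi i) l).
exists (phi \o psi); split; first by move=> i j ij; apply/phi_incr/psi_incr.
move=> k; rewrite inE => /orP[/eqP -> //|ks] i j ij.
by apply: (h k ks); case: ltngtP ij => // [/psi_incr/ltnW//|->].
Qed.

End Dickson.

(** * Noetherianity; decomposition of algebraic sets into irreducible ones *)

Section Noetherian.
Context {R : realType}.

(* Groebner-style Hilbert basis theorem: otherwise choose in each ideal
   (p 0, ..., p j) an element outside of (p 0, ..., p j.-1) with least leading
   monomial; by Dickson's lemma, one of these can be reduced by a former one. *)
Lemma noetherian n (p : nat -> mpoly n R) :
  exists j (c : nat -> mpoly n R), p j = \sum_(i < j) c i * p i.
Proof.
pose I j : set (mpoly n R) := [set q | exists c : nat -> mpoly n R, q = \sum_(i < j) c i * p i].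
have I0 j : I j 0.
  by exists (fun=> 0); rewrite big1// => i _; rewrite mul0r.
have IB j q r a : I j q -> I j r -> I j (q - a * r).
  move=> [c ->] [d ->]; exists (fun i => c i - a * d i).
  by rewrite mulr_sumr -sumrB; apply: eq_bigr => i _; rewrite mulrBl mulrA.
have IS j q : I j q -> I j.+1 q.
  move=> [c ->]; exists (fun i => if i == j then 0 else c i).
  rewrite big_ord_recr/= eqxx mul0r addr0; apply: eq_bigr => i _.
  by rewrite ltn_eqF.
have Ile i j q : (i <= j)%N -> I i q -> I j q.
  by move=> /subnK <-; elim: (_ - _)%N => //= k IH /IH /IS.
have Ip j : I j.+1 (p j).
  exists (fun i => (i == j)%:R); rewrite big_ord_recr/= eqxx mul1r big1 ?add0r// => i _.
  by rewrite ltn_eqF// mul0r.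
suff [j Ij] : exists j, I j (p j) by exists j.
apply: contrapT => /forallNP nI.
have /choice[f fP] : forall j, exists q, [/\ I j.+1 q, ~ I j q &
    forall q', I j.+1 q' -> (mlead q' < mlead q)%O -> I j q'].
  move=> j; apply: contrapT => h.
  have : forall m q, mlead q = m -> I j.+1 q -> I j q.
    move=> m; elim/(@ltmwf n): m => m IH q qm Iq; apply: contrapT => nIq.
    apply: h; exists q; split=> // q' Iq' lt; apply: (IH (mlead q')) => //.
    by rewrite -qm.
  by move=> /(_ _ _ erefl (Ip j)); exact: nI.
have f0 j : f j != 0 by apply/eqP => fj; have [_ + _] := fP j; rewrite fj; apply; exact: I0.
have [i [j [ij /mnm_lepP le_ij]]] := dickson (fun j => mlead (f j)).
have [Ifi _ _] := fP i; have [Ifj nIfj minfj] := fP j.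
(* The factor is chosen so that [a * f i] has the same leading term as [f j]; their difference [g]
   then has a smaller leading monomial, which contradicts the choice of [f j]. *)
pose a := (mcoeff (mlead (f j)) (f j) / mcoeff (mlead (f i)) (f i)) *:
          mpolyX R (mnm_sub (mlead (f j)) (mlead (f i))).
have lc0 k : mcoeff (mlead (f k)) (f k) != 0 by rewrite mleadc_eq0.
have a0 : mcoeff (mlead (f j)) (f j) / mcoeff (mlead (f i)) (f i) != 0.
  by rewrite mulf_neq0 ?invr_eq0.
have X0 m : mpolyX R m != 0 :> mpoly n R.
  by apply/eqP => /(congr1 (mcoeff m)) /eqP; rewrite mcoeffX mcoeff0 eqxx oner_eq0.
have nza : a != 0 by rewrite /a scaler_eq0 negb_or a0 X0.
have leadaf : mlead (a * f i) = mlead (f j).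
  by rewrite mleadM// /a mleadZ// mleadXm submK//; apply/mnm_lepP.
have coefaf : mcoeff (mlead (f j)) (a * f i) = mcoeff (mlead (f j)) (f j).
  rewrite -{1}leadaf mleadM// mleadcM /a mleadcZE mleadXm mcoeffX eqxx mulr1.
  by rewrite divfK.
pose g := f j - a * f i.
have Ig : I j.+1 g by apply: IB => //; apply: Ile Ifi; apply: ltnW.
have nIg : ~ I j g.
  move=> Ig'; apply: nIfj; have := IB _ _ _ (- a) Ig' (Ile _ _ _ ij Ifi).
  by rewrite mulNr opprK subrK.
apply: (nIg); apply: minfj => //.
have g0 : g != 0 by apply: contra_not_neq nIg => ->.
rewrite lt_neqAle; apply/andP; split.
  apply: contraNneq g0 => lead_g.
  by rewrite -mleadc_eq0 lead_g mcoeffB coefaf subrr.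
by apply: le_trans (mleadB_le _ _) _; rewrite leadaf joinxx.
Qed.


(** A counterexample yields a strictly decreasing sequence [V i]. Choose [p i] vanishing on [V i.+1]
    but not on [V i]: some [p j] is a combination of the former ones, all of which vanish on [V j],
    a contradiction. *)
Lemma algebraic_ind {N} (P : set 'rV[R]_N -> Prop) :
  (forall V, algebraic V -> (forall W, algebraic W -> W `<=` V -> W <> V -> P W) -> P V) ->
  forall V, algebraic V -> P V.
Proof.
move=> step V0 aV0; apply: contrapT => nPV0.
have /choice[next nextP] : forall V, exists W : set 'rV[R]_N, algebraic V -> ~ P V ->
    [/\ algebraic W, W `<=` V, W <> V & ~ P W].
  move=> V; have [aV|naV] := pselect (algebraic V); last by exists V.
  have [PV|nPV] := pselect (P V); first by exists V.
  apply: contrapT => /forallNP h; apply: nPV; apply: step => // W aW WV nWV.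
  by apply: contrapT => nPW; apply: (h W).
pose V i := iter i next V0.
have VP i : algebraic (V i) /\ ~ P (V i).
  elim: i => [//|i [aV nPV]]; by have [] := nextP _ aV nPV.
have VS i : V i.+1 `<=` V i /\ V i.+1 <> V i.
  by have [aV nPV] := VP i; have [] := nextP _ aV nPV.
have Vle i j : (i <= j)%N -> V j `<=` V i.
  by move=> /subnK <-; elim: (_ - _)%N => //= k IH x /(VS _).1 /IH.
have /choice[p pP] : forall i, exists p : mpoly N R, (forall x, V i.+1 x -> peval p x = 0) /\
    exists2 x, V i x & peval p x != 0.
  move=> i; apply: contrapT => /forallNP h; apply: (VS i).2; apply/seteqP.
  split; first exact: (VS i).1.
  have [[J VJ] _] := VP i.+1; move=> x Vx; rewrite VJ => q Jq.
  apply: contrapT => /eqP qx; apply: (h q); split; last by exists x.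
  by move=> y; rewrite VJ; apply.
have [j [c pj]] := noetherian p.
have [_ [x Vx]] := pP j; rewrite pj /peval raddf_sum/= big1 ?eqxx// => i _.
by rewrite mevalM; rewrite [X in _ * X](pP i).1 ?mulr0//; apply: (Vle i.+1 j).
Qed.

Lemma algebraicI_poly {N} (V : set 'rV[R]_N) f : algebraic V -> polyfun f ->
  algebraic (V `&` [set x | f x = 0]).
Proof.
move=> [J ->] [p fp]; exists (J `|` [set p]); apply/seteqP; split=> x /=.
  by move=> [h fx] q [/h//|->]; rewrite -fp.
by move=> h; split=> [q Jq|]; [apply: h; left|rewrite fp; apply: h; right].
Qed.

Lemma algebraicT {N} : algebraic (setT : set 'rV[R]_N).
Proof. by exists set0; apply/seteqP; split=> x // _ p. Qed.

Lemma algebraic_eq0 {N} (f : 'rV[R]_N -> R) : polyfun f -> algebraic [set x | f x = 0].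
Proof. by move=> fp; rewrite -[X in algebraic X]setTI; exact: (algebraicI_poly algebraicT fp). Qed.

(** Starting from the whole space, violated equations of [V] are added one by one and merged as sums
    of squares; the induction on algebraic sets makes this end. *)
Lemma algebraic_zero_set {N} (V : set 'rV[R]_N) : algebraic V ->
  exists2 f, polyfun f & V = [set x | f x = 0].
Proof.
move=> [J VJ].
suff h : forall W : set 'rV[R]_N, algebraic W -> V `<=` W ->
    (exists2 f, polyfun f & W = [set x | f x = 0]) ->
    exists2 f, polyfun f & V = [set x | f x = 0].
  apply: (h _ algebraicT) => //; exists (fun=> 0); first exact: polyfun_cst.
  by apply/seteqP; split.
apply: algebraic_ind => W aW IH VW [f fp Wf].
have [->|nVW] := pselect (V = W); first by exists f.
have [p [Jp [y Wy py]]] : exists p, J p /\ exists2 y, W y & peval p y != 0.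
  apply: contrapT => /forallNP h; apply: nVW; apply/seteqP; split=> // x Wx.
  by rewrite VJ => q Jq; apply: contrapT => /eqP qx; apply: (h q); split=> //; exists x.
apply: (IH (W `&` [set x | peval p x = 0])).
- exact: (algebraicI_poly aW (polyfun_peval p)).
- by move=> x [].
- by move=> eqW; move: Wy; rewrite -eqW => -[_] /= py0; rewrite py0 eqxx in py.
- by move=> x Vx; split; [exact: VW|move: Vx; rewrite VJ; apply].
exists (fun x => f x ^+ 2 + peval p x ^+ 2).
  by apply: polyfunD; apply: polyfunX => //; exact: polyfun_peval.
rewrite Wf; apply/seteqP; split=> x /=; first by move=> [-> ->]; rewrite expr0n addr0.
move/eqP; rewrite paddr_eq0 ?sqr_ge0// !expf_eq0/= => /andP[/eqP ? /eqP ?].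
by split.
Qed.

Lemma semialgebraic_algebraic {N} (V : set 'rV[R]_N) : algebraic V -> semialgebraic V.
Proof. by move=> /algebraic_zero_set[f fp ->]; exact: semialgebraic_eq0. Qed.

Lemma irreducible_decomposition {N} (V : set 'rV[R]_N) : algebraic V ->
  exists s : nat -> set 'rV[R]_N, exists n, 
    (forall i, (i < n)%N -> irreducible_algebraic (s i)) /\
    V = [set x | exists2 i, (i < n)%N & s i x].
Proof.
move: V; apply: algebraic_ind => V aV IH.
have [V0|/set0P V0] := eqVneq V set0.
  by exists (fun=> set0), 0%N; split=> //; rewrite V0; apply/seteqP; split=> x // [].
have [irr|nirr] := pselect (irreducible_algebraic V).
  exists (fun=> V), 1%N; split=> //; apply/seteqP; split=> x; last by case.
  by exists 0%N.
have [A [B [aA [aB [AB [nA nB]]]]]] : exists A B, algebraic A /\ algebraic B /\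
    V = A `|` B /\ V <> A /\ V <> B.
  apply: contrapT => h; apply: nirr; split=> // A B aA aB AB.
  have [->|nA] := pselect (V = A); first by left.
  have [->|nB] := pselect (V = B); first by right.
  by exfalso; apply: h; exists A, B.
have [||s [n [sirr As]]] := IH A aA; [by rewrite AB; left|by move=> /esym|].
have [||t [m [tirr Bt]]] := IH B aB; [by rewrite AB; right|by move=> /esym|].
exists (fun i => if (i < n)%N then s i else t (i - n)%N), (n + m)%N; split.
  move=> i inm; case: ltnP => ni; first exact: sirr.
  by apply: tirr; rewrite ltn_subLR.
rewrite AB As Bt; apply/seteqP; split=> x /=.
  move=> [[i ilt sx]|[i ilt tx]]; first by exists i; rewrite ?ilt// ltn_addr.
  by exists (n + i)%N; rewrite ?ltn_add2l// ltnNge leq_addr/= addKn.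
move=> [i inm]; case: ltnP => ni h; [by left; exists i|right; exists (i - n)%N => //].
by rewrite ltn_subLR.
Qed.

(** [V] is the union of its parts where [f] and where [g] vanishes, and irreducibility makes one of
    them all of [V]. *)
Lemma irreducible_prime {N} (V : set 'rV[R]_N) f g : irreducible_algebraic V ->
  polyfun f -> polyfun g -> (forall x, V x -> f x * g x = 0) ->
  (forall x, V x -> f x = 0) \/ (forall x, V x -> g x = 0).
Proof.
move=> [aV _ irr] fp gp fg.
have := irr _ _ (algebraicI_poly aV fp) (algebraicI_poly aV gp).
have -> : V `&` [set x | f x = 0] `|` V `&` [set x | g x = 0] = V.
  rewrite -setIUr; apply/setIidPl => x Vx /=.
  by move/eqP: (fg x Vx); rewrite mulf_eq0 => /orP[/eqP|/eqP]; [left|right].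
move=> /(_ erefl)[] VE; [left|right] => x; rewrite VE; by case.
Qed.

End Noetherian.

(** * Chains of irreducible sets and the dimension of semialgebraic images *)

Section SemialgebraicImages.
Context {R : realType}.

Lemma irreducible_point {N} (x : 'rV[R]_N) : irreducible_algebraic [set x].
Proof.
split; [|by exists x|].
  exists [set p | peval p x = 0]; apply/seteqP; split=> [y -> //|y /= h].
  apply/rowP => i; apply/eqP; rewrite -subr_eq0.
  have := h (mpolyX R (mnm1 i) - mpolyC N (x ord0 i)).
  by rewrite /peval !mevalB !mevalXU !mevalC subrr => ->.
move=> A B _ _ AB; have /= : (A `|` B) x by rewrite -AB.
by move=> []h; [left|right]; apply/seteqP; split=> y /=; [move=> ->|move=> hy|move=> ->|move=> hy] => //;
  have : (A `|` B) y by [left|right]; by rewrite -AB.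
Qed.

Lemma irreducible_chain0 {N} (V : set 'rV[R]_N) x : V x -> irreducible_chain V 0.
Proof.
move=> Vx; exists (fun=> [set x]); split=> // i _; split; first exact: irreducible_point.
by move=> y ->.
Qed.

Lemma sub_irreducible_chain {N} (V W : set 'rV[R]_N) d :
  W `<=` V -> irreducible_chain W d -> irreducible_chain V d.
Proof.
move=> WV [C [Cirr Cincr]]; exists C; split=> // i /Cirr[? CW].
by split=> // x /CW /WV.
Qed.

Lemma irreducible_chainS {N} (V W : set 'rV[R]_N) d : irreducible_algebraic V ->
  W `<` V -> irreducible_chain W d -> irreducible_chain V d.+1.
Proof.
move=> Virr; rewrite properEneq => -[WV sWV] [C [Cirr Cincr]].
exists (fun i => if (i <= d)%N then C i else V); split=> i.
  case: (leqP i d) => [id _|_ _]; last by split.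
  by have [? CW] := Cirr i id; split=> // x /CW /sWV.
rewrite ltnS => id; rewrite id; case: (leqP i.+1 d) => h; first exact: Cincr.
have [_ CW] := Cirr i id; rewrite properEneq; split; last by move=> x /CW /sWV.
apply: contraNN WV => /eqP CV; apply/eqP/seteqP; split=> //.
by rewrite -CV.
Qed.

(** Each hypothesis provides an equation of the set which is not identically zero on [V]; as the
    ideal of [V] is prime, the product of the two serves for the union. *)
Lemma irreducible_avoid {N} (V : set 'rV[R]_N) (A B : set 'rV[R]_N) :
  irreducible_algebraic V ->
  (exists f, [/\ polyfun f, forall x, A x -> f x = 0 & exists2 x, V x & f x != 0]) ->
  (exists f, [/\ polyfun f, forall x, B x -> f x = 0 & exists2 x, V x & f x != 0]) ->
  exists f, [/\ polyfun f, forall x, (A `|` B) x -> f x = 0 & exists2 x, V x & f x != 0].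
Proof.
move=> Virr [f [fp fA [x Vx fx]]] [g [gp gB [y Vy gy]]].
exists (fun x => f x * g x); split; first exact: polyfunM.
  by move=> z [/fA ->|/gB ->]; rewrite ?mul0r ?mulr0.
apply: contrapT => h; have [|h1|h1] := irreducible_prime Virr fp gp.
- by move=> z Vz; apply: contrapT => /eqP ?; apply: h; exists z.
- by rewrite h1 ?eqxx in fx.
- by rewrite h1 ?eqxx in gy.
Qed.

(* On a piece {p = 0, q > 0} of G, either some p is not identically zero on
   V x R, hence p(_, c) is nonzero on V for all but finitely many c, or the
   piece is open in the direction of c, hence empty, G being functional. *)
Lemma level_sets_not_dense {N} (V : set 'rV[R]_N) (G : 'rV[R]_N -> 'rV[R]_1 -> Prop) :
  irreducible_algebraic V ->
  semialgebraic [set z | G (lsubmx z) (rsubmx z)] ->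
  (forall x t t', G x t -> G x t' -> t = t') -> (forall x t, G x t -> V x) ->
  exists2 r : {poly R}, r != 0 & forall c, r.[c] != 0 -> exists f,
    [/\ polyfun f, forall x, G x c%:M -> f x = 0 & exists2 x, V x & f x != 0].
Proof.
move=> Virr [b Gb] Gfun GV.
have GE x c : G x c <-> exists2 st, st \in b & basic_set st (row_mx x c).
  have -> : G x c = [set z | G (lsubmx z) (rsubmx z)] (row_mx x c).
    by rewrite /= row_mxKl row_mxKr.
  by rewrite Gb.
have [_ [v Vv] _] := Virr.
have V1 : exists2 x, V x & (1 : R) != 0 by exists v => //; exact: oner_neq0.
suff h st : st \in b -> exists2 r : {poly R}, r != 0 & forall c, r.[c] != 0 ->
    exists f, [/\ polyfun f, forall x, basic_set st (row_mx x c%:M) -> f x = 0 &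
                  exists2 x, V x & f x != 0].
  have : exists2 r : {poly R}, r != 0 & forall c, r.[c] != 0 -> exists f,
      [/\ polyfun f, forall x, (exists2 st, st \in b & basic_set st (row_mx x c%:M)) -> f x = 0 &
                  exists2 x, V x & f x != 0].
    elim: b h {Gb GE} => [_|st b IH h].
      exists 1; first exact: oner_neq0.
      by move=> c _; exists (fun=> 1); split=> //; [exact: polyfun_cst|move=> x []].
    have [|r r0 hr] := IH; first by move=> s sb; apply: h; rewrite inE sb orbT.
    have [r' r'0 hr'] := h st (mem_head _ _).
    exists (r * r'); first by rewrite mulf_neq0.
    move=> c; rewrite hornerM mulf_eq0 negb_or => /andP[/hr rc /hr' r'c].
    have [f [fp f0 fV]] := irreducible_avoid Virr r'c rc.
    exists f; split=> // x [s]; rewrite inE => /orP[/eqP -> hs|sb hs]; apply: f0.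
      by left.
    by right; exists s.
  move=> [r r0 hr]; exists r => // c /hr[f [fp f0 fV]]; exists f; split=> // x.
  by move=> /GE; exact: f0.
move=> stb.
have [Z|] := pselect (forall p, p \in st.1 -> forall x (t : R), V x -> peval p (row_mx x t%:M) = 0).
  exists 1; first exact: oner_neq0.
  move=> c _; exists (fun=> 1); split=> //; first exact: polyfun_cst.
  move=> x hx; exfalso; have Gxc : G x c%:M by apply/GE; exists st.
  have [_ /polyfun_gt0_box_seq[e e0 he]] := hx.
  have Gxc' : G x (c + e / 2)%:M.
    apply/GE; exists st => //; split=> [p ps|]; first by apply: Z => //; exact: GV Gxc.
    apply: he; apply: box_row_mx => i; first by rewrite subrr normr0.
    rewrite !ord1 !mxE eqxx !mulr1n addrC addKr.
    by rewrite gtr0_norm ?divr_gt0// ltr_pdivrMr// ltr_pMr// ltr1n.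
  have /matrixP/(_ 0 0) := Gfun _ _ _ Gxc Gxc'.
  rewrite !mxE eqxx !mulr1n => /eqP; rewrite -subr_eq0 opprD addNKr.
  by rewrite oppr_eq0 mulf_eq0 invr_eq0 (gt_eqF e0) pnatr_eq0.
move=> /existsNP[p /not_implyP[ps /existsNP[x0 /existsNP[t0 /not_implyP[Vx0 /eqP px0]]]]].
have line (t : R) : row_mx x0 0 + t *: row_mx 0 1%:M = row_mx x0 t%:M :> 'rV[R]_(N + 1).
  by rewrite scale_row_mx add_row_mx scaler0 addr0 add0r scale_scalar_mx mulr1.
(* [r] is [p] along the fibre over [x0]; wherever [r] is nonzero at [c], the polynomial [p(_, c)] is
   nonzero at [x0]. *)
have [r hr] := polyfun_line (row_mx x0 0) (row_mx 0 1%:M) (polyfun_peval p).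
exists r.
  by apply: contraNneq px0 => r0; rewrite -line hr r0 horner0.
move=> c rc; exists (fun x => peval p (row_mx x c%:M)); split.
- apply: (polyfun_comp (polyfun_peval p) (g := fun x => row_mx x c%:M)).
  by apply: polymap_row; [exact: polymap_id|exact: polymap_cst].
- by move=> x [+ _]; exact.
- by exists x0 => //; rewrite -line hr.
Qed.

(** Here [G] is the graph of a partial map on [V]. Induction on [d]: for [V] irreducible, the image
    contains a box. For a suitable level [c] of the first coordinate in this box, the level set lies
    in a proper algebraic subset [W] of [V], and the other coordinates map it onto a set containing
    a box. The chain obtained in [W] is extended by [V]. *)
Lemma irreducible_chain_of_image d N (V : set 'rV[R]_N)
    (G : 'rV[R]_N -> 'rV[R]_d -> Prop) :
  algebraic V -> semialgebraic [set z | G (lsubmx z) (rsubmx z)] ->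
  (forall x t t', G x t -> G x t' -> t = t') -> (forall x t, G x t -> V x) ->
  ~ thin [set t | exists x, G x t] -> irreducible_chain V d.
Proof.
elim: d V G => [|d IH] V G aV sG Gfun GV nthin.
  have [x Vx] : exists x, V x.
    apply: contrapT => /forallNP h; apply: nthin; apply: sub_thin thin0 => t [x /GV].
    exact: h.
  exact: irreducible_chain0 Vx.
have sVG W : algebraic W ->
    semialgebraic [set z : 'rV[R]_(N + d.+1) | W (lsubmx z) /\ G (lsubmx z) (rsubmx z)].
  move=> /semialgebraic_algebraic sW; apply: semialgebraicI sG.
  by apply: (semialgebraic_preimage (f := lsubmx)) => //; exact: polymap_lsub polymap_id.
have sswap : polymap (fun z : 'rV[R]_(d.+1 + N) => row_mx (rsubmx z) (lsubmx z)).
  by apply: polymap_row; [exact: polymap_rsub polymap_id|exact: polymap_lsub polymap_id].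
(* A finite union of thin sets is thin, so the image of some irreducible component of [V] is not
   thin. *)
wlog Virr : V G aV sG Gfun GV nthin sVG / irreducible_algebraic V.
  move=> wlg; have [s [n [sirr Vs]]] := irreducible_decomposition aV.
  have [i ilt ni] : exists2 i, (i < n)%N & ~ thin [set t | exists x, s i x /\ G x t].
    apply: contrapT => h; apply: nthin.
    have := @thin_bigU _ _ _ (iota 0 n) (fun i => [set t | exists x, s i x /\ G x t]).
    move=> /(_ _)/sub_thin; apply.
      move=> t [x Gxt]; have := GV _ _ Gxt; rewrite Vs => -[i ilt six].
      by exists i; rewrite ?mem_iota//; exists x.
    move=> i; rewrite mem_iota /= => ilt; apply: contrapT => ni; apply: h.
    by exists i.
  have siV : s i `<=` V by move=> x; rewrite Vs; exists i.
  have [asi _ _] := sirr i ilt.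
  apply: sub_irreducible_chain siV _.
  apply: (wlg (s i) (fun x t => s i x /\ G x t)) => //.
  - exact: sVG.
  - by move=> x t t' [_ h] [_]; exact: Gfun h.
  - by move=> x t [].
  - move=> W aW; have := semialgebraicI (sVG _ aW) (sVG _ asi).
    apply: eq_semialgebraic => z /=; tauto.
  - exact: sirr.
pose G1 x (c : 'rV[R]_1) := exists t : 'rV[R]_d, G x (row_mx c t : 'rV[R]_(1 + d)).
have sG1 : semialgebraic [set z | G1 (lsubmx z) (rsubmx z)].
  apply: semialgebraic_ex.
  have : polymap (fun z : 'rV[R]_(N + 1 + d) => row_mx (lsubmx (lsubmx z))
      (row_mx (rsubmx (lsubmx z)) (rsubmx z) : 'rV[R]_(1 + d)) : 'rV[R]_(N + (1 + d))).
    apply: polymap_row; first exact/polymap_lsub/polymap_lsub/polymap_id.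
    apply: polymap_row; first exact/polymap_rsub/polymap_lsub/polymap_id.
    exact/polymap_rsub/polymap_id.
  move=> /semialgebraic_preimage /(_ sG); apply: eq_semialgebraic => z /=.
  by rewrite row_mxKl row_mxKr.
have sT : semialgebraic [set t | exists x, G x t].
  apply: semialgebraic_ex.
  move: sswap => /semialgebraic_preimage /(_ sG); apply: eq_semialgebraic => z /=.
  by rewrite row_mxKl row_mxKr.
have [t0 [e [e0 boxT]]] := semialgebraic_not_thin sT nthin.
have G1fun x c c' : G1 x c -> G1 x c' -> c = c'.
  by move=> [t Gxt] [t' Gxt']; have [] := @eq_row_mx _ 1 1 d _ _ _ _ (Gfun _ _ _ Gxt Gxt').
have G1V x c : G1 x c -> V x by move=> [t /GV].
have [r r0 hr] := level_sets_not_dense Virr sG1 G1fun G1V.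
pose c0 := t0 ord0 ord0.
have [||c /andP[c1 c2] /hr[f [fp f0 [v Vv fv]]]] := @poly_nonroot _ r (c0 - e) (c0 + e).
- by [].
- by rewrite ltrD2l gt0_cp.
pose W := V `&` [set x | f x = 0].
have WV : W `<` V.
  rewrite properEneq; split; last by move=> x [].
  by apply: contraNN fv => /eqP WV; move: Vv; rewrite -WV => -[_ /= ->].
apply: (irreducible_chainS Virr WV).
apply: (IH W (fun x t => G x (row_mx c%:M t : 'rV[R]_(1 + d)))).
- exact: algebraicI_poly.
- have : polymap (fun z : 'rV[R]_(N + d) => row_mx (lsubmx z)
      (row_mx c%:M (rsubmx z) : 'rV[R]_(1 + d)) : 'rV[R]_(N + (1 + d))).
    apply: polymap_row; first exact/polymap_lsub/polymap_id.
    apply: polymap_row; first exact/polymap_cst.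
    exact/polymap_rsub/polymap_id.
  move=> /semialgebraic_preimage /(_ sG); apply: eq_semialgebraic => z /=.
  by rewrite row_mxKl row_mxKr.
- by move=> x t t' Gxt Gxt'; have [] := @eq_row_mx _ 1 1 d _ _ _ _ (Gfun _ _ _ Gxt Gxt').
- by move=> x t Gxt; split; [exact: GV Gxt|apply: f0; exists t].
apply: contra_not (@box_not_thin _ _ (@rsubmx _ 1 1 d t0) _ e0) => /sub_thin; apply.
move=> t tbox; apply: boxT; rewrite -(@hsubmxK _ 1 1 d t0).
apply: (@box_row_mx _ 1 d) tbox => j; rewrite !ord1 !mxE eqxx mulr1n.
have -> : lshift d 0 = ord0 :> 'I_(1 + d) by apply/val_inj.
rewrite -/c0 ltr_norml. apply/andP; split; lra.
Qed.

End SemialgebraicImages.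

(** * Algebraically independent polynomials on a chain of irreducible sets *)

Section AlgebraicIndependence.
Context {R : realType}.

Lemma row_mx_scalar {d} (s : 'rV[R]_(1 + d)) : s = row_mx (s ord0 ord0)%:M (rsubmx s).
Proof.
rewrite -[LHS]hsubmxK; congr row_mx; rewrite [LHS]mx11_scalar mxE; congr (s _ _)%:M.
exact/val_inj.
Qed.

(** [i] is the least exponent of the first variable with a coefficient that is not identically zero;
    this coefficient is the value of [Q] where the first variable is 0. *)
Lemma polyfun_lowest_term {d} (P : 'rV[R]_(1 + d) -> R) : polyfun P ->
  (exists s, P s != 0) -> exists i (Q : 'rV[R]_(1 + d) -> R), [/\ polyfun Q,
    exists s, Q (row_mx 0 s) != 0 &
    forall (t : R) s, P (row_mx t%:M s) = t ^+ i * Q (row_mx t%:M s)].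
Proof.
move=> Pp [s0 Ps0]; have [n [c [cp PE]]] := polyfun_split Pp.
have ex : exists i, `[< exists s, c i s != 0 >].
  apply: contrapT => /forallNP h; move: Ps0; rewrite (row_mx_scalar s0) PE.
  rewrite big1 ?eqxx// => i _; apply/eqP; rewrite mulf_eq0; apply/orP; left.
  by apply/negPn/negP => ci; apply: (h i); apply/asboolP; eexists; exact: ci.
case: (ex_minnP ex) => i /asboolP[s cis] imin.
exists i, (fun z : 'rV[R]_(1 + d) => \sum_(l < n | (i <= l)%N) c l (rsubmx z) * (z ord0 ord0) ^+ (l - i)).
have entry0 (t : R) (s' : 'rV[R]_d) : (row_mx t%:M s' : 'rV[R]_(1 + d)) ord0 ord0 = t.
  have -> : ord0 = lshift d ord0 :> 'I_(1 + d) by apply/val_inj.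
  by rewrite (row_mxEl (t%:M : 'M[R]_1) s' ord0 ord0) mxE eqxx mulr1n.
have c_lt l s' : (l < i)%N -> c l s' = 0.
  move=> li; apply/eqP/negPn/negP => cl; have := imin l.
  by rewrite leqNgt li; apply/implyP; apply/asboolP; exists s'.
split.
- apply: polyfun_sum => l _; apply: polyfunM; last exact/polyfunX/polyfun_coord.
  by apply: (polyfun_comp (cp l)); exact: polymap_rsub polymap_id.
- exists s; rewrite (_ : 0 = 0%:M) ?entry0 ?row_mxKr; last by rewrite raddf0.
  have [ni|ilt] := leqP n i.
    exfalso; move: Ps0; rewrite (row_mx_scalar s0) PE big1 ?eqxx// => l _.
    by rewrite c_lt ?mul0r//; apply: leq_trans ni.
  rewrite (bigD1 (Ordinal ilt))//= subnn expr0 mulr1 big1 ?addr0// => l /andP[il nl].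
  by rewrite expr0n subn_eq0 leqNgt ltn_neqAle il andbT eq_sym nl mulr0.
move=> t s'; rewrite PE entry0 row_mxKr (bigID (fun l : 'I_n => (i <= l)%N))/=.
rewrite [X in _ + X]big1 ?addr0; last by move=> l; rewrite -ltnNge => /c_lt ->; rewrite mul0r.
rewrite mulr_sumr; apply: eq_bigr => l il.
by rewrite mulrCA -exprD subnKC.
Qed.

(* For a chain C, the j-th function of g vanishes on C j but not on C j.+1. *)
Lemma irreducible_chain_independent {N} d (V : set 'rV[R]_N) : irreducible_chain V d ->
  exists g : 'rV[R]_N -> 'rV[R]_d, polymap g /\
    forall P, polyfun P -> (forall x, V x -> P (g x) = 0) -> forall s, P s = 0.
Proof.
move=> [C [Cirr Cincr]].
suff [g [gp gind]] : exists g : 'rV[R]_N -> 'rV[R]_d, polymap g /\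
    forall P, polyfun P -> (forall x, C d x -> P (g x) = 0) -> forall s, P s = 0.
  exists g; split=> // P Pp PV; apply: gind => // x Cx; apply: PV.
  exact: (Cirr d (leqnn d)).2.
elim: d Cirr Cincr => [|d IH] Cirr Cincr.
  exists (fun=> 0); split; first exact: polymap_cst.
  move=> P _ P0 s; have [[_ [x Cx] _] _] := Cirr 0%N isT.
  by rewrite [s]thinmx0; exact: (P0 x).
have [||g [gp gind]] := IH.
- by move=> i id; apply: Cirr; apply: leqW.
- by move=> i id; apply: Cincr; apply: leqW.
have [CC nCC] := Cincr d (ltnSn d).
have [f [fp f0 [v Cv fv]]] : exists f, [/\ polyfun f, forall x, C d x -> f x = 0 &
    exists2 x, C d.+1 x & f x != 0].
  have [[[J CJ] _ _] _] := Cirr d (leqnSn d).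
  have [v [Cv nCv]] : exists v, C d.+1 v /\ ~ C d v.
    apply: contrapT => /forallNP h; apply: nCC => x Cx.
    by apply: contrapT => nx; apply: (h x).
  move: nCv; rewrite CJ => /existsNP[p /not_implyP[Jp /eqP pv]].
  exists (peval p); split; [exact: polyfun_peval|by move=> x; apply|].
  by exists v.
exists (fun x => row_mx (f x)%:M (g x) : 'rV[R]_(1 + d)).
have fgp : polymap (fun x => row_mx (f x)%:M (g x) : 'rV[R]_(1 + d)).
  apply: polymap_row => // i; apply: eq_polyfun fp => x.
  by rewrite !ord1 mxE eqxx mulr1n.
split=> // P Pp PC s; apply: contrapT => /eqP Ps.
(* Since [f ^+ i] is not identically zero on the irreducible set [C d.+1], the cofactor [Q(f, g)]
   vanishes there. On [C d], where [f] is 0, this reads [Q(0, g) = 0], which the independence of [g]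
   excludes. *)
have [||i [Q [Qp [s0 Qs0] PQ]]] := @polyfun_lowest_term d P; [exact: Pp|by exists s|].
have [Cirr' _] := Cirr d.+1 (leqnn _).
have Qfg : polyfun (fun x => Q (row_mx (f x)%:M (g x))) by apply: polyfun_comp Qp _.
have [|h|h] := irreducible_prime Cirr' (polyfunX i fp) Qfg.
- by move=> x Cx; rewrite -PQ; exact: PC.
- by have /eqP := h v Cv; rewrite expf_eq0 (negbTE fv) andbF.
move: Qs0; rewrite (gind (fun s => Q (row_mx 0 s))) ?eqxx//.
  apply: (polyfun_comp Qp).
  by apply: polymap_row; [exact: polymap_cst|exact: polymap_id].
by move=> x Cx; have := h x (CC x Cx); rewrite f0// raddf0.
Qed.

(** The last member of the chain serves, as it contains the others. *)
Lemma irreducible_chain_top {N} (V : set 'rV[R]_N) d : irreducible_chain V d ->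
  exists W, [/\ irreducible_algebraic W, W `<=` V & irreducible_chain W d].
Proof.
move=> [C [Cirr Cincr]]; have [Cd CdV] := Cirr d (leqnn d).
exists (C d); split=> //; exists C; split=> // j jd; split; first exact: (Cirr j jd).1.
rewrite -(subKn jd); elim: (d - j)%N (leq_subr j d) => [|k IH] kd; first by rewrite subn0.
move=> x Cx; apply: (IH (ltnW kd)).
by have := (Cincr (d - k.+1)%N); rewrite subnSK// leq_subr => /(_ isT)[+ _]; apply.
Qed.

(** Otherwise each [s i] has an equation that is not identically zero on [W], and by
    [irreducible_avoid] so does their union, which contains [W]. *)
Lemma irreducible_sub_union {N} (W : set 'rV[R]_N) (s : nat -> set 'rV[R]_N) n :
  irreducible_algebraic W -> (forall i, (i < n)%N -> algebraic (s i)) ->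
  (forall x, W x -> exists2 i, (i < n)%N & s i x) -> exists2 i, (i < n)%N & W `<=` s i.
Proof.
move=> Wirr sa sW; apply: contrapT => h.
have : exists f, [/\ polyfun f, forall x, (exists2 i, (i < n)%N & s i x) -> f x = 0 &
    exists2 x, W x & f x != 0].
  elim: n sa h {sW} => [_ _|n IH sa h].
    have [_ [w Ww] _] := Wirr; exists (fun=> 1); split; first exact: polyfun_cst.
      by move=> x [].
    by exists w => //; exact: oner_neq0.
  have [|||f [fp f0 fW]] := irreducible_avoid (A := s n) Wirr _ (IH _ _).
  - have [f fp sf] := algebraic_zero_set (sa n (ltnSn n)).
    exists f; split=> //; first by move=> x; rewrite sf.
    apply: contrapT => h'; apply: h; exists n => // x Wx; rewrite sf /=.
    by apply: contrapT => /eqP fx; apply: h'; exists x.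
  - by move=> i ilt; apply: sa; apply: leqW.
  - by move=> [i ilt Wi]; apply: h; exists i => //; apply: leqW.
  exists f; split=> // x [i]; rewrite ltnS leq_eqVlt => /predU1P[->|ilt] six; apply: f0.
    by left.
  by right; exists i.
move=> [f [_ f0 [w Ww]]]; rewrite f0 ?eqxx//; exact: sW.
Qed.

End AlgebraicIndependence.

(** * Cutting algebraic sets by generic linear forms *)

Section CuttingByLinearForms.
Context {R : realType}.

(** Each condition is the nonvanishing of a nonzero polynomial in [l], and the product of these is
    nonzero somewhere in any box around [l0]. *)
Lemma linear_form_avoiding {m} (n : nat) (y : nat -> 'rV[R]_m) (l0 : 'cV[R]_m) e :
  0 < e -> (forall i, (i < n)%N -> y i != 0) ->
  exists l : 'cV[R]_m, (forall j, `|l j 0 - l0 j 0| < e) /\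
    forall i, (i < n)%N -> y i *m l != 0.
Proof.
move=> e0 y0.
pose f (v : 'rV[R]_m) := \prod_(i < n) (y i *m v^T) 0 0.
have fip i : polyfun (fun v : 'rV[R]_m => (y i *m v^T) 0 0).
  apply: (@eq_polyfun _ _ (fun v => \sum_j y i 0 j * v ord0 j)).
    by move=> v; rewrite mxE; apply: eq_bigr => j _; rewrite mxE.
  by apply: polyfun_sum => j _; apply: polyfunM; [exact: polyfun_cst|exact: polyfun_coord].
have fp : polyfun f by apply: polyfun_prod.
have f0 : exists2 v, [set: 'rV[R]_m] v & f v != 0.
  apply: (polyfun_prod_neq0 (f := fun (i : 'I_n) v => (y i *m v^T) 0 0)) => //.
    by exists 0.
  move=> i _; have /rV0Pn[j yj] := y0 i (ltn_ord i).
  by exists (delta_mx 0 j) => //; rewrite trmx_delta -colE mxE.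
have [v [_ vbox] fv] := polyfun_neq0_box (x := l0^T) line_closedT fp f0 I e0.
exists v^T; split=> [j|i ilt]; first by have := vbox j; rewrite !mxE.
by apply: contraNneq fv => yv; rewrite /f (bigD1 (Ordinal ilt))//= yv mxE mul0r.
Qed.

(* Each further column of L cuts the dimension down by one. *)
Lemma generic_kernel_avoids {m} d (T : set 'rV[R]_m) (L0 : 'M[R]_(m, d)) e :
  algebraic T -> ~ T 0 -> ~ irreducible_chain T d -> 0 < e ->
  exists L : 'M[R]_(m, d), (forall i j, `|L i j - L0 i j| < e) /\
    forall y, T y -> y *m L != 0.
Proof.
elim: d T L0 => [|d IH] T L0 aT T0 nchain e0.
  (* Without a chain of length 0, [T] is empty. *)
  exists L0; split=> [i [] //|y Ty]; exfalso; apply: nchain.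
  exact: irreducible_chain0 Ty.
have [s [n [sirr Ts]]] := irreducible_decomposition aT.
(* A point of each component, nonzero because [T] avoids 0; a linear form that is nonzero at all
   these points vanishes identically on no component. *)
have /choice[y yP] : forall i, exists y, (i < n)%N -> s i y.
  move=> i; have [ilt|] := boolP (i < n)%N; last by exists 0.
  by have [_ [x sx] _] := sirr i ilt; exists x.
have [||l [ll0 yl]] := @linear_form_avoiding m n y (lsubmx (L0 : 'M[R]_(m, 1 + d))) e.
- exact: e0.
- move=> i ilt; apply: contra_not_neq T0 => yi; rewrite Ts; exists i => //.
  by rewrite -yi; exact: yP.
pose lf (x : 'rV[R]_m) := (x *m l) 0 0.
have lfp : polyfun lf by apply: polymap_lin.
have [|||//|L' [LL0 TL]] := IH (T `&` [set x | lf x = 0]) (rsubmx (L0 : 'M[R]_(m, 1 + d))).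
- exact: algebraicI_poly.
- by move=> [].
(* A chain of length [d] in the cut set would lie in one component of [T]; this component is not
   inside the kernel of [l], so it would extend the chain to length [d.+1]. *)
- move=> /irreducible_chain_top[W [Wirr WT Wchain]]; apply: nchain.
  have [||i ilt Wsi] := irreducible_sub_union (n := n) (s := s) Wirr.
  - by move=> i /sirr[].
  - by move=> x /WT[]; rewrite Ts.
  apply: (@sub_irreducible_chain _ _ _ (s i)); first by move=> x; rewrite Ts; exists i.
  apply: irreducible_chainS Wchain; first exact: sirr.
  split=> // /(_ _ (yP i ilt))/WT[_ /= h]; have := yl i ilt; apply/negP/negPn/eqP.
  by apply/matrixP => a b; rewrite !ord1 [LHS]h mxE.
exists (row_mx l L' : 'M[R]_(m, 1 + d)); split.
  move=> i; change (forall j : 'I_(1 + d), `|(row_mx l L' : 'M[R]_(m, 1 + d)) i j - L0 i j| < e).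
  move=> j; rewrite -(splitK j); case: (fintype.split j) => b /=.
    by rewrite (row_mxEl l L' i b) ord1; have := ll0 i; rewrite mxE.
  by rewrite (row_mxEr l L' i b); have := LL0 i b; rewrite mxE.
move=> x Tx; apply/eqP => h.
have : row_mx (x *m l) (x *m L') = row_mx 0 0 :> 'rV[R]_(1 + d).
  by rewrite row_mx0 -mul_mx_row.
move=> /(@eq_row_mx _ 1 1 d)[xl xL].
suff /TL : (T `&` [set x | lf x = 0]) x by rewrite xL eqxx.
by split=> //=; rewrite /lf xl mxE.
Qed.

End CuttingByLinearForms.

(** * Limits at infinity of the directions of F *)

Section LimitDirections.
Context {R : realType} {N m k : nat}.
Variables (X : set 'rV[R]_N) (F : 'rV[R]_N -> 'rV[R]_m).
Hypothesis sF : semialgebraic_map X F.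

Lemma semialgebraic_value {M} (f : 'rV[R]_M -> 'rV[R]_N) (u : 'rV[R]_M -> 'rV[R]_m) :
  polymap f -> polymap u -> semialgebraic [set z | X (f z) /\ F (f z) = u z].
Proof.
move=> fp up; have := semialgebraic_preimage (polymap_row fp up) sF.
apply: eq_semialgebraic => z /=; split=> [[x Xx /eq_row_mx[<- <-]]//|[Xf Fu]].
by exists (f z) => //; rewrite Fu.
Qed.

(** A form of [t = 1/|x|^2] and [y = F(x)/|F(x)|] without roots or divisions; it forces [x] and
    [F x] to be nonzero. *)
Definition direction_at (x : 'rV[R]_N) (t : R) (y : 'rV[R]_m) : Prop :=
  [/\ X x, t * sqn x = 1, sqn y = 1 & exists2 a, 0 < a & F x = a *: y].

Definition limit_directions : set 'rV[R]_m := [set y | sqn y = 1 /\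
  forall e, 0 < e -> exists x t y', [/\ direction_at x t y', `|t| < e & box y e y']].

Lemma direction_at_unique x t t' y y' :
  direction_at x t y -> direction_at x t' y' -> t = t' /\ y = y'.
Proof.
move=> [_ tx y1 [a a0 Fa]] [_ t'x y'1 [a' a'0 Fa']]; split.
  have x0 : sqn x != 0.
    by apply: contra_eq_neq tx => ->; rewrite mulr0 eq_sym oner_neq0.
  by apply: (mulIf x0); rewrite tx t'x.
have aa' : a = a'.
  apply/eqP; rewrite -(eqrXn2 (n := 2))// ?ltW//.
  by have /eqP := congr1 sqn (etrans (esym Fa) Fa'); rewrite !sqnZ y1 y'1 !mulr1.
by apply: (scalerI (lt0r_neq0 a0)); rewrite -Fa Fa' aa'.
Qed.

Variable V : set 'rV[R]_N.
Hypotheses (aV : algebraic V) (XV : X `<=` V) (dimV : ~ irreducible_chain V k.+1).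

Lemma limit_directions_dependent (g : 'rV[R]_m -> 'rV[R]_k) : polymap g ->
  exists c, [/\ polyfun c, exists s, c s != 0 &
    forall y, limit_directions y -> c (g y) = 0].
Proof.
move=> gp.
(* The graph of the map from [x] to the pair of [1/|x|^2] and [g(F(x)/|F(x)|)], with values in a
   space of dimension [1 + k]. *)
pose G (x : 'rV[R]_N) (s : 'rV[R]_(1 + k)) :=
  exists y, direction_at x (s ord0 ord0) y /\ rsubmx s = g y.
have sG : semialgebraic [set z : 'rV[R]_(N + (1 + k)) | G (lsubmx z) (rsubmx z)].
  apply: semialgebraic_ex => /=; rewrite /direction_at.
  pose z1 (z : 'rV[R]_(N + (1 + k) + m)) := lsubmx (lsubmx z).
  pose z2 (z : 'rV[R]_(N + (1 + k) + m)) := rsubmx (lsubmx z).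
  have z1p : polymap z1 by exact/polymap_lsub/polymap_lsub/polymap_id.
  have z2p : polymap z2 by exact/polymap_rsub/polymap_lsub/polymap_id.
  have z3p : polymap (fun z : 'rV[R]_(N + (1 + k) + m) => rsubmx z).
    exact/polymap_rsub/polymap_id.
  have s1 := semialgebraic_eq0 (polyfunB (polyfunM (z2p ord0) (polyfun_sqn z1p)) (polyfun_cst 1)).
  have s2 := semialgebraic_eq0 (polyfunB (polyfun_sqn z3p) (polyfun_cst 1)).
  have s3 := semialgebraic_eq (polymap_rsub z2p) (polymap_comp gp z3p).
  have s4 : semialgebraic [set z | exists a : 'rV[R]_1,
      (X (z1 z) /\ F (z1 z) = a 0 0 *: rsubmx z) /\ 0 < a 0 0].
    apply: semialgebraic_ex.
    have ap : polyfun (fun w : 'rV[R]_(N + (1 + k) + m + 1) => rsubmx w 0 0).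
      exact: polymap_rsub polymap_id 0.
    apply: semialgebraicI; last exact: semialgebraic_gt0.
    apply: (semialgebraic_value (f := z1 \o lsubmx)
      (u := fun w : 'rV[R]_(N + (1 + k) + m + 1) => rsubmx w 0 0 *: rsubmx (lsubmx w))).
      exact: polymap_comp z1p (polymap_lsub polymap_id).
    exact: polymapZ ap (polymap_rsub (polymap_lsub polymap_id)).
  apply: eq_semialgebraic (semialgebraicI (semialgebraicI s1 s2) (semialgebraicI s3 s4)) => z /=.
  split=> [[[/subr0_eq h1 /subr0_eq h2] [h3 [a [[Xz Fz] a0]]]]|].
    by split=> //; split=> //; exists (a 0 0).
  move=> [[Xz h1 h2 [a a0 Fz]] h3]; split; split; rewrite ?h1 ?h2 ?subrr//.
  by exists a%:M; rewrite mxE eqxx mulr1n.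
have [P [Pp P0 PG]] : thin [set s : 'rV[R]_(1 + k) | exists x, G x s].
  apply: contrapT => nthin; apply: dimV.
  apply: (irreducible_chain_of_image (G := G) aV sG _ _ nthin).
    move=> x s s' [y [Ey sy]] [y' [Ey' sy']].
    have [ss' yy'] := direction_at_unique Ey Ey'.
    by rewrite (row_mx_scalar s) (row_mx_scalar s') ss' sy sy' yy'.
  by move=> x s [y [[Xx _ _ _] _]]; exact: XV.
have [i [Q [Qp Q0 PQ]]] := polyfun_lowest_term Pp P0.
exists (fun s => Q (row_mx 0 s)); split=> //.
  apply: (polyfun_comp Qp).
  by apply: polymap_row; [exact: polymap_cst|exact: polymap_id].
move=> y [y1 ylim]; apply/eqP; rewrite -sqrf_eq0; apply/negPn/negP => Qy.
(* If the relation failed at [y], then [h] would be positive at [(0, y)] and hence at some nearby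
   [(t, y')] coming from a point of [X]; but there [P = t ^+ i * Q] vanishes while [t] is nonzero.
   The square turns being nonzero into being positive. *)
pose h (z : 'rV[R]_(1 + m)) := Q (row_mx (lsubmx z) (g (rsubmx z))) ^+ 2.
have hp : polyfun h.
  apply: polyfunX; apply: (polyfun_comp Qp (g := fun z : 'rV[R]_(1 + m) => row_mx _ _)).
  apply: polymap_row; first exact: polymap_lsub polymap_id.
  exact: polymap_comp gp (polymap_rsub polymap_id).
have [|e e0 he] := polyfun_gt0_box (x := row_mx 0 y) hp.
  by rewrite /h row_mxKl row_mxKr lt_def Qy sqr_ge0.
have [x [t [y' [Ey te yy']]]] := ylim e e0.
have : 0 < h (row_mx t%:M y').
  by apply/he/box_row_mx => // j; rewrite !ord1 !mxE eqxx subr0.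
rewrite /h row_mxKl row_mxKr.
have t0 : t != 0.
  have [_ + _ _] := Ey; apply: contra_eq_neq => ->.
  by rewrite mul0r eq_sym oner_neq0.
have : P (row_mx t%:M (g y')) = 0.
  apply: PG; exists x, y'; rewrite row_mxKr; split=> //.
  suff -> : (row_mx t%:M (g y') : 'rV[R]_(1 + k)) ord0 ord0 = t by [].
  have -> : ord0 = lshift k ord0 :> 'I_(1 + k) by apply/val_inj.
  by rewrite (row_mxEl (t%:M : 'M[R]_1) (g y') ord0 ord0) mxE eqxx mulr1n.
rewrite PQ => /eqP; rewrite mulf_eq0 expf_eq0 (negbTE t0) andbF /= => /eqP ->.
by rewrite expr0n ltxx.
Qed.

(** [T] is the Zariski closure of the limit directions, so every polynomial relation between them
    extends to [T]: in particular [sqn y = 1], which excludes 0, and the relation between [k]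
    polynomials, which excludes a chain of length [k]. *)
Lemma limit_directions_algebraic_hull : exists T, [/\ algebraic T,
  limit_directions `<=` T, ~ T 0 & ~ irreducible_chain T k].
Proof.
pose J : set (mpoly m R) := [set p | forall y, limit_directions y -> peval p y = 0].
pose T : set 'rV[R]_m := [set y | forall p, J p -> peval p y = 0].
have closed_T f : polyfun f -> (forall y, limit_directions y -> f y = 0) ->
    forall y, T y -> f y = 0.
  by move=> [p fp] fS y Ty; rewrite fp; apply: Ty => z Sz; rewrite -fp; exact: fS.
exists T; split.
- by exists J.
- by move=> y Sy p; apply.
- move=> T0; have : sqn (0 : 'rV[R]_m) - 1 = 0.
    apply: (closed_T (fun y => sqn y - 1)) T0; last by move=> y [-> _]; rewrite subrr.
    by apply: polyfunB; [exact: polyfun_sqn polymap_id|exact: polyfun_cst].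
  by move=> /eqP; rewrite sqn0 sub0r oppr_eq0 oner_eq0.
move=> /irreducible_chain_independent[g [gp gind]].
have [c [cp [s cs] cS]] := limit_directions_dependent gp.
move: cs; rewrite gind ?eqxx//.
exact: closed_T (polyfun_comp cp gp) cS.
Qed.

End LimitDirections.

(** * Boundedness and compactness in terms of the squared Euclidean norm *)

Section Compactness.
Context {R : realType}.

Lemma bounded_set_sqn N (A : set 'rV[R]_N) :
  bounded_set A <-> exists C, forall x, A x -> sqn x <= C.
Proof.
split=> [[M [_ AM]]|[C AC]].
  exists (\sum_(i < N) (M + 1) ^+ 2) => x Ax; apply: ler_sum => i _.
  have xM : `|x| <= M + 1 by apply: AM => //; rewrite ltrDl.
  rewrite -real_normK ?num_real// lerXn2r ?nnegrE//.
    exact: le_trans xM.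
  apply: le_trans xM; rewrite [leRHS]/Num.norm /= mx_normrE; apply/bigmax_geP; right => /=.
  by exists (ord0, i).
(* The bound comes from [|a| <= 1 + a^2] in each coordinate. *)
exists (1 + C); split=> [|M CM x Ax]; first exact: num_real.
apply: le_trans (ltW CM); rewrite [leLHS]/Num.norm /= mx_normrE.
apply/bigmax_leP; split=> [|[i j] _ /=].
  by apply: addr_ge0 => //; apply: le_trans (AC x Ax); exact: sqn_ge0.
rewrite (ord1 i); apply: (@le_trans _ _ (1 + x ord0 j ^+ 2)).
  rewrite -real_normK ?num_real//; have := normr_ge0 (x ord0 j).
  by set a := `|_|; nra.
rewrite lerD2l; apply: le_trans (AC x Ax).
by rewrite /sqn (bigD1 j)//= lerDl sumr_ge0// => l _; exact: sqr_ge0.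
Qed.

Lemma compact_sphere m : compact [set y : 'rV[R]_m | sqn y = 1].
Proof.
apply: bounded_closed_compact.
  by apply/bounded_set_sqn; exists 1 => y ->.
have sqnc : continuous (fun y : 'rV[R]_m => sqn y).
  by apply: polyfun_continuous; exact: polyfun_sqn polymap_id.
have -> : [set y : 'rV[R]_m | sqn y = 1] = sqn @^-1` [set 1] by [].
by apply: preimage_closed => //; exact: closed_eq.
Qed.

Lemma invn_lt (e : R) : 0 < e -> exists n0 : nat, forall n, (n0 <= n)%N -> n.+1%:R^-1 < e.
Proof.
move=> e0; exists (Num.truncn e^-1) => n en; rewrite -(invrK e) ltf_pV2 ?posrE ?invr_gt0//.
apply: lt_le_trans (truncnS_gt _) _; by rewrite ler_nat.
Qed.

End Compactness.

(** * The bad matrices form a thin set *)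

Section BadProjections.
Context {R : realType} {N m k : nat}.
Variables (X : set 'rV[R]_N) (F : 'rV[R]_N -> 'rV[R]_m).

(** The single parameter [e] both sends [x] to infinity, by [|x|^2 >= 1/e], and makes the ratio of
    [|F(x) L|^2] to [|F(x)|^2] small; squared norms keep the conditions polynomial in [x], [F x],
    [L] and [e]. *)
Definition bad_projection (L : 'M[R]_(m, k)) : Prop := forall e : R, 0 < e ->
  exists x, [/\ X x, 1 <= e * sqn x & sqn (F x *m L) <= e * sqn (F x)].

Lemma semialgebraic_bad_projection : semialgebraic_map X F ->
  semialgebraic [set v : 'rV[R]_(m * k) | bad_projection (vec_mx v)].
Proof.
move=> sF.
(* The variable [w] stands for the pair of [x] and [F x], so that [F] enters only through its
   graph. *)
have : semialgebraic [set v : 'rV[R]_(m * k) | forall e : 'rV[R]_1, 0 < e 0 0 ->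
    exists w : 'rV[R]_(N + m), (X (lsubmx w) /\ F (lsubmx w) = rsubmx w) /\
      0 <= e 0 0 * sqn (lsubmx w) - 1 /\
      0 <= e 0 0 * sqn (rsubmx w) - sqn (rsubmx w *m vec_mx v)].
  apply: semialgebraic_all.
  have e_p : polyfun (fun z : 'rV[R]_(m * k + 1) => rsubmx z 0 0).
    exact: polymap_rsub polymap_id 0.
  have := semialgebraicC (semialgebraic_gt0 e_p).
  set A := (A in semialgebraic A) => sA.
  have : semialgebraic [set z : 'rV[R]_(m * k + 1) | exists w : 'rV[R]_(N + m),
      (X (lsubmx w) /\ F (lsubmx w) = rsubmx w) /\
      0 <= rsubmx z 0 0 * sqn (lsubmx w) - 1 /\
      0 <= rsubmx z 0 0 * sqn (rsubmx w) - sqn (rsubmx w *m vec_mx (lsubmx z))].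
    apply: semialgebraic_ex.
    have xp : polymap (fun y : 'rV[R]_(m * k + 1 + (N + m)) => lsubmx (rsubmx y)).
      exact/polymap_lsub/polymap_rsub/polymap_id.
    have up : polymap (fun y : 'rV[R]_(m * k + 1 + (N + m)) => rsubmx (rsubmx y)).
      exact/polymap_rsub/polymap_rsub/polymap_id.
    have vp : polymap (fun y : 'rV[R]_(m * k + 1 + (N + m)) => lsubmx (lsubmx y)).
      exact/polymap_lsub/polymap_lsub/polymap_id.
    have ep : polyfun (fun y : 'rV[R]_(m * k + 1 + (N + m)) => rsubmx (lsubmx y) 0 0).
      exact: polymap_rsub (polymap_lsub polymap_id) 0.
    apply: semialgebraicI; first exact: semialgebraic_value.
    apply: semialgebraicI; apply: semialgebraic_ge0.
      apply: polyfunB; last exact: polyfun_cst.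
      by apply: polyfunM => //; exact: polyfun_sqn.
    apply: polyfunB; first by apply: polyfunM => //; exact: polyfun_sqn.
    apply: polyfun_sqn => j.
    apply: (@eq_polyfun _ _ (fun y => \sum_i rsubmx (rsubmx y) 0 i *
       lsubmx (lsubmx y) 0 (mxvec_index i j))).
      by move=> y; rewrite mxE; apply: eq_bigr => i _; rewrite [vec_mx _ _ _]mxE.
    by apply: polyfun_sum => i _; apply: polyfunM.
  move=> /(semialgebraicU sA); apply: eq_semialgebraic => z /=.
  split=> [[|]//|h]; have [/h|] := pselect (0 < rsubmx z 0 0); [by right|by left].
apply: eq_semialgebraic => v; split=> h e e0.
  have [|w [[Xw Fw] [h1 h2]]] := h e%:M; first by rewrite mxE eqxx mulr1n.
  exists (lsubmx w); rewrite Fw; move: h1 h2; rewrite mxE eqxx mulr1n !subr_ge0.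
  by split.
have [x [Xx h1 h2]] := h _ e0.
by exists (row_mx x (F x)); rewrite row_mxKl row_mxKr !subr_ge0; split.
Qed.

(** Bad points for [e] tending to 0 give unit vectors [y n] with [y n *m L] tending to 0; a cluster
    point on the compact sphere is the required limit. *)
Lemma bad_projection_kills_limit (L : 'M[R]_(m, k)) :
  compact (zeros X F) -> bad_projection L -> exists2 y, limit_directions X F y & y *m L = 0.
Proof.
move=> /compact_bounded/bounded_set_sqn[C zC] bad.
have C0 : 0 < `|C| + 1 by rewrite ltr_wpDl.
have /choice[y yP] : forall n : nat, exists y : 'rV[R]_m, exists x t,
    [/\ direction_at X F x t y, `|t| <= n.+1%:R^-1 & sqn (y *m L) <= n.+1%:R^-1].
  (* The second bound forces [|x|^2 > C], beyond all zeros of [F], so that the direction of [F x]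
     exists. *)
  move=> n; pose e := Num.min n.+1%:R^-1 (`|C| + 1)^-1.
  have e0 : 0 < e by rewrite lt_min !invr_gt0 ltr0n.
  have en : e <= n.+1%:R^-1 by rewrite ge_min lexx.
  have eC : e <= (`|C| + 1)^-1 by rewrite ge_min lexx orbT.
  have [x [Xx ex FxL]] := bad e e0.
  have x0 : 0 < sqn x by rewrite -(pmulr_rgt0 _ e0); exact: lt_le_trans ex.
  have Fx0 : F x != 0.
    apply/eqP => Fx; have /zC : zeros X F x by [].
    apply/negP; rewrite -ltNge; apply: le_lt_trans (ler_norm C) _.
    apply: (@lt_le_trans _ _ (`|C| + 1)); first by rewrite ltrDl.
    by rewrite -(ler_pM2l e0); apply: le_trans ex; rewrite -ler_pdivlMr// mul1r.
  have sF0 : 0 < sqn (F x) by rewrite sqn_gt0.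
  pose a := Num.sqrt (sqn (F x)).
  have a0 : 0 < a by rewrite sqrtr_gt0.
  have a2 : a ^+ 2 = sqn (F x) by rewrite sqr_sqrtr// ltW.
  exists (a^-1 *: F x), x, (sqn x)^-1; split.
  - split=> //; first by rewrite mulVf// gt_eqF.
      by rewrite sqnZ exprVn a2 mulVf// gt_eqF.
    by exists a => //; rewrite scalerA divff ?scale1r// gt_eqF.
  - rewrite gtr0_norm ?invr_gt0//; apply: le_trans en.
    by rewrite -[leLHS]mul1r ler_pdivrMr.
  - rewrite -scalemxAl sqnZ exprVn a2 ler_pdivrMl// mulrC.
    by apply: le_trans FxL _; rewrite ler_pM2r.
have ysphere n : sqn (y n) = 1 by have [x [t [[_ _ -> _] _ _]]] := yP n.
have [z [z1 zcl]] : [set y : 'rV[R]_m | sqn y = 1] `&` cluster (y @ \oo) !=set0.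
  by apply: compact_sphere; exists 0%N => // n _; exact: ysphere.
have near_z e : 0 < e -> forall n0, exists2 n, (n0 <= n)%N & box z e (y n).
  move=> e0 n0.
  have tail : (y @ \oo) [set w | exists2 n, (n0 <= n)%N & w = y n].
    by exists n0 => // n n0n; exists n.
  have boxz : nbhs z (box z e).
    apply/nbhs_ballP; exists e => //= w [_ zw] i.
    by have := zw ord0 i; rewrite /ball /= distrC.
  by have [_ [[n n0n ->] ?]] := zcl _ _ tail boxz; exists n.
exists z.
  split=> // e e0; have [n0 hn0] := invn_lt e0.
  have [n n0n zn] := near_z e e0 n0; have [x [t [h1 h2 h3]]] := yP n.
  by exists x, t, (y n); split=> //; apply: le_lt_trans h2 (hn0 n n0n).
apply/eqP; rewrite -sqn_eq0 eq_le sqn_ge0 andbT leNgt; apply/negP => zL.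
pose d := sqn (z *m L) / 2.
have d0 : 0 < d by rewrite divr_gt0.
have hp : polyfun (fun w : 'rV[R]_m => sqn (w *m L) - d).
  by apply: polyfunB; [exact: polyfun_sqn (polymap_lin L)|exact: polyfun_cst].
have [|e e0 he] := polyfun_gt0_box (x := z) hp.
  by rewrite subr_gt0 /d; lra.
have [n0 hn0] := invn_lt d0.
have [n n0n /he] := near_z e e0 n0; have [x [t [h1 h2 h3]]] := yP n.
by rewrite subr_gt0 ltNge (le_trans h3)// ltW// hn0.
Qed.

(** Otherwise the bad matrices fill a box, but this box contains a matrix whose kernel avoids the
    hull of the limit directions. *)
Lemma bad_projection_thin (V : set 'rV[R]_N) : algebraic V -> X `<=` V ->
  ~ irreducible_chain V k.+1 -> semialgebraic_map X F -> compact (zeros X F) ->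
  thin [set v : 'rV[R]_(m * k) | bad_projection (vec_mx v)].
Proof.
move=> aV XV dimV sF zF; apply: contrapT => nthin.
have [v [e [e0 vbad]]] := semialgebraic_not_thin (semialgebraic_bad_projection sF) nthin.
have [T [aT ST T0 dimT]] := limit_directions_algebraic_hull sF aV XV dimV.
have [L [Lv TL]] := generic_kernel_avoids (vec_mx v) aT T0 dimT e0.
have : box v e (mxvec L).
  move=> i; rewrite -[v](vec_mxK v); case/mxvec_indexP: i => i j.
  by rewrite !mxvecE.
move=> /vbad; rewrite /= mxvecK => /(bad_projection_kills_limit zF)[y /ST/TL].
by move=> /eqP.
Qed.

End BadProjections.

(** * Comparison of Lojasiewicz exponents at infinity *)

Section LojasiewiczExponents.
Context {R : realType} {N : nat}.
Variable X : set 'rV[R]_N.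

Lemma loj_exp_infty_le {m k} (G : 'rV[R]_N -> 'rV[R]_m) (H : 'rV[R]_N -> 'rV[R]_k) (a e : R) :
  0 < a -> 0 < e ->
  (forall x, X x -> 1 <= e * sqn x -> a * sqn (G x) <= sqn (H x)) ->
  (loj_exp_infty X G <= loj_exp_infty X H)%E.
Proof.
move=> a0 e0 GH; apply: ereal_sup_le => _ [nu [C [r [C0 r0 h]]] <-].
exists nu => //.
have se0 : 0 < Num.sqrt e^-1 by rewrite sqrtr_gt0 invr_gt0.
(* Square roots of the constants in the squared comparison: beyond the radius [Num.sqrt e^-1] one
   has [1 <= e * sqn x]. *)
exists (Num.sqrt a * C), (Num.max r (Num.sqrt e^-1)); split.
- by rewrite mulr_gt0// sqrtr_gt0.
- by rewrite lt_max r0.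
move=> x Xx; rewrite ge_max => /andP[rx ex].
have {}ex : 1 <= e * sqn x.
  rewrite -ler_pdivrMl// mulr1 -ler_sqrt//; exact: sqn_ge0.
rewrite -mulrA; apply: (@le_trans _ _ (Num.sqrt a * enorm (G x))).
  by rewrite ler_pM2l ?sqrtr_gt0//; exact: h.
rewrite -[enorm (G x)]/(Num.sqrt (sqn (G x))) -[enorm (H x)]/(Num.sqrt (sqn (H x))).
by rewrite -sqrtrM ?(ltW a0)// ler_sqrt ?sqn_ge0//; exact: GH.
Qed.

Lemma sqn_mulmx_le m k (L : 'M[R]_(m, k)) :
  exists2 B, 0 < B & forall u : 'rV[R]_m, sqn (u *m L) <= B * sqn u.
Proof.
exists (1 + \sum_j (\sum_i `|L i j|) ^+ 2).
  by rewrite ltr_pwDl// sumr_ge0// => j _; exact: sqr_ge0.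
move=> u; apply: (@le_trans _ _ ((\sum_j (\sum_i `|L i j|) ^+ 2) * sqn u)).
  rewrite mulr_suml; apply: ler_sum => j _.
  have usqr : Num.sqrt (sqn u) ^+ 2 = sqn u by rewrite sqr_sqrtr// sqn_ge0.
  rewrite -real_normK ?num_real// -usqr -exprMn lerXn2r ?nnegrE//.
    by rewrite mulr_ge0 ?sqrtr_ge0// sumr_ge0.
  rewrite mxE; apply: le_trans (ler_norm_sum _ _ _) _.
  rewrite mulr_suml; apply: ler_sum => i _; rewrite normrM mulrC ler_wpM2l//.
  rewrite -sqrtr_sqr ler_sqrt ?sqn_ge0// /sqn (bigD1 i)//= lerDl.
  by rewrite sumr_ge0// => l _; exact: sqr_ge0.
by rewrite ler_wpM2r ?sqn_ge0// lerDr.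
Qed.

Lemma loj_exp_infty_lin_comp_le {m k} (F : 'rV[R]_N -> 'rV[R]_m) (L : 'M[R]_(m, k)) :
  (loj_exp_infty X (lin_comp L F) <= loj_exp_infty X F)%E.
Proof.
have [B B0 FL] := sqn_mulmx_le L.
apply: (@loj_exp_infty_le _ _ _ _ B^-1 1); rewrite ?invr_gt0// => x _ _.
by rewrite ler_pdivrMl//; exact: FL.
Qed.

Lemma loj_exp_infty_lin_comp {m k} (F : 'rV[R]_N -> 'rV[R]_m) (L : 'M[R]_(m, k)) (a e : R) :
  0 < a -> 0 < e ->
  (forall x, X x -> 1 <= e * sqn x -> a * sqn (F x) <= sqn (F x *m L)) ->
  loj_exp_infty X F = loj_exp_infty X (lin_comp L F).
Proof.
move=> a0 e0 h; apply/eqP; rewrite eq_le loj_exp_infty_lin_comp_le andbT.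
exact: loj_exp_infty_le h.
Qed.

Lemma good_projection {m k} (F : 'rV[R]_N -> 'rV[R]_m) (L : 'M[R]_(m, k)) :
  ~ bad_projection X F L -> exists2 e, 0 < e &
  forall x, X x -> 1 <= e * sqn x -> e * sqn (F x) < sqn (F x *m L).
Proof.
move=> /existsNP[e /not_implyP[e0 /forallNP h]]; exists e => // x Xx ex.
by rewrite ltNge; apply/negP => FL; apply: (h x).
Qed.

(** The strict inequality of [good_projection] rules out zeros with [|x|^2 >= 1/e], and the zero set
    is closed by continuity. *)
Lemma compact_zeros_lin_comp {m k} (F : 'rV[R]_N -> 'rV[R]_m) (L : 'M[R]_(m, k)) :
  closed X -> {within X, continuous F} -> ~ bad_projection X F L ->
  compact (zeros X (lin_comp L F)).
Proof.
move=> clX Fc /good_projection[e e0 good]; apply: bounded_closed_compact.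
  apply/bounded_set_sqn; exists e^-1 => x [Xx /= FL0].
  rewrite leNgt; apply/negP => ex; have := good x Xx.
  rewrite -ler_pdivrMl// mulr1 => /(_ (ltW ex)).
  by rewrite [F x *m L]FL0 sqn0 ltNge mulr_ge0 ?sqn_ge0// ltW.
have -> : zeros X (lin_comp L F) = X `&` ((fun u : 'rV[R]_m => sqn (u *m L)) \o F) @^-1` [set 0].
  apply/seteqP; split=> x [Xx /= h]; split=> //=.
    by apply/eqP; rewrite sqn_eq0; apply/eqP.
  by apply/eqP; rewrite -sqn_eq0; apply/eqP.
have cL : continuous (fun u : 'rV[R]_m => sqn (u *m L)).
  by apply: polyfun_continuous; exact: polyfun_sqn (polymap_lin L).
rewrite closed_setSI//; apply: preimage_closed; last exact: closed_eq.
by move=> x _; exact: continuous_comp (Fc x) (cL (F x)).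
Qed.

End LojasiewiczExponents.

(** * Genericity among all matrices and in [Delta]; degrees of generic combinations *)

Section Genericity.
Context {R : realType} {m k : nat}.

(** The exceptional set is the zero set of [f]; its complement is dense in [A] because [f] is
    nonzero somewhere on [A] near each of its points. *)
Lemma generically_polyfun (A : set 'M[R]_(m, k)) (P : 'M[R]_(m, k) -> Prop) f :
  line_closed [set v | A (vec_mx v)] -> polyfun f ->
  (exists2 v, A (vec_mx v) & f v != 0) ->
  (forall L, A L -> f (mxvec L) != 0 -> P L) -> generically A P.
Proof.
move=> Al fp f0 h; exists [set v | f v = 0]; split.
- exact: algebraic_eq0.
- move=> L AL B /nbhs_entrywise[e e0 he].
  have [|v [Av Lv] fv] := polyfun_neq0_box (x := mxvec L) Al fp f0 _ e0.
    by rewrite /= mxvecK.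
  exists (vec_mx v); split; first by split=> //=; rewrite vec_mxK; exact/eqP.
  by apply: he => i j; have := Lv (mxvec_index i j); rewrite mxvecE mxE.
- by move=> L [AL /eqP fL]; exact: h.
Qed.

(** Evaluation at the basis vectors shows that the first [k] rows form the identity matrix and the
    other rows are free. *)
Lemma DeltaP (lekm : (k <= m)%N) (L : 'M[R]_(m, k)) :
  Delta lekm L <-> forall (l : 'I_m) (i : 'I_k), (l < k)%N -> L l i = (l == i :> nat)%:R.
Proof.
split=> [[alpha La] l i lk|h].
  have := La (delta_mx 0 l) i; rewrite -rowE !mxE eqxx/= => ->.
  rewrite big1 ?addr0; first by rewrite eq_sym -val_eqE.
  move=> j kj; rewrite mxE eqxx/= (_ : j == l = false) ?mulr0//.
  by apply: contraTF lk => /eqP <-; rewrite -leqNgt.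
exists (fun i j => L j i) => y i; rewrite mxE (bigID (fun l : 'I_m => (l < k)%N))/=.
congr (_ + _); last first.
  by apply: eq_big => [l|l _]; [rewrite -leqNgt|rewrite mulrC].
rewrite (bigD1 (widen_ord lekm i)) ?ltn_ord//= h/= ?ltn_ord// eqxx mulr1.
rewrite big1 ?addr0// => l /andP[lk li]; rewrite h//.
by rewrite (_ : (l == i :> nat) = false) ?mulr0//; apply: contraNF li.
Qed.

Lemma Delta_line_closed (lekm : (k <= m)%N) :
  line_closed [set v : 'rV[R]_(m * k) | Delta lekm (vec_mx v)].
Proof.
move=> v w t /DeltaP hv /DeltaP hw; apply/DeltaP => l i lk.
rewrite !mxE; have := hv l i lk; have := hw l i lk.
by rewrite !mxE => -> ->; rewrite subrr mulr0 addr0.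
Qed.

Definition top_block (lekm : (k <= m)%N) (L : 'M[R]_(m, k)) : 'M[R]_k :=
  \matrix_(i, j) L (widen_ord lekm i) j.

Lemma polyfun_det_top (lekm : (k <= m)%N) :
  polyfun (fun v : 'rV[R]_(m * k) => \det (top_block lekm (vec_mx v))).
Proof.
have entryp i j : polyfun (fun v : 'rV[R]_(m * k) => top_block lekm (vec_mx v) i j).
  apply: (@eq_polyfun _ _ (fun v => v ord0 (mxvec_index (widen_ord lekm i) j))).
    by move=> v; rewrite !mxE.
  exact: polyfun_coord.
apply: polyfun_sum => s _; apply: polyfunM; first exact: polyfun_cst.
by apply: polyfun_prod => i _; exact: entryp.
Qed.

Lemma Delta_pid_mx (lekm : (k <= m)%N) : Delta lekm (pid_mx k : 'M[R]_(m, k)).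
Proof. by apply/DeltaP => l i lk; rewrite mxE lk andbT. Qed.

(* L and L * A have the same kernel for invertible A, so a condition on kernels
   which is generic for all matrices is generic on Delta, up to a choice of A. *)
Lemma Delta_polyfun_neq0 (lekm : (k <= m)%N) (f : 'rV[R]_(m * k) -> R) :
  polyfun f -> (exists v, f v != 0) -> exists2 A : 'M[R]_k, A \in unitmx &
  exists2 v, Delta lekm (vec_mx v) & f (mxvec (vec_mx v *m A)) != 0.
Proof.
move=> fp [v0 fv0].
(* The matrix of [v] is chosen with an invertible top block as well; this block is [A], and
   multiplication by its inverse leads into [Delta]. *)
have [||v _] := polyfun_mul_neq0 line_closedT fp (polyfun_det_top lekm).
- by exists v0.
- exists (mxvec (pid_mx k)) => //; rewrite mxvecK (_ : top_block _ _ = 1%:M).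
    by rewrite det1 oner_neq0.
  by apply/matrixP => i j; rewrite !mxE/= ltn_ord andbT.
rewrite mulf_eq0 negb_or => /andP[fv dv].
have Au : top_block lekm (vec_mx v) \in unitmx by rewrite unitmxE unitfE.
exists (top_block lekm (vec_mx v)) => //.
exists (mxvec (vec_mx v *m invmx (top_block lekm (vec_mx v)))); last first.
  by rewrite mxvecK mulmxKV// vec_mxK.
rewrite mxvecK; apply/DeltaP => l i lk.
have -> : l = widen_ord lekm (Ordinal lk) by apply/val_inj.
have := mulmxV Au => /matrixP/(_ (Ordinal lk) i); rewrite [RHS]mxE => <-.
by rewrite !mxE; apply: eq_bigr => j _; rewrite [in RHS]mxE.
Qed.

Lemma polymap_mulmxr (A : 'M[R]_k) :
  polymap (fun v : 'rV[R]_(m * k) => mxvec (vec_mx v *m A)).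
Proof.
move=> i; case/mxvec_indexP: i => i j.
apply: (@eq_polyfun _ _ (fun v => \sum_l v ord0 (mxvec_index i l) * A l j)).
  by move=> v; rewrite mxvecE mxE; apply: eq_bigr => l _; rewrite mxE.
by apply: polyfun_sum => l _; apply: polyfunM; [exact: polyfun_coord|exact: polyfun_cst].
Qed.

(** For [L] in [Delta], the j-th component involves only [f] at [j], with coefficient 1, and at
    indices from [k] on, where degrees are no larger. The last hypothesis prevents the leading
    monomial from cancelling. *)
Lemma mpdeg_lin_comp_poly N (lekm : (k <= m)%N) (f : 'I_m -> mpoly N R)
    (L : 'M[R]_(m, k)) (j : 'I_k) :
  (forall i j : 'I_m, (i <= j)%N -> (mpdeg (f j) <= mpdeg (f i))%N) ->
  (forall i, (0 < mpdeg (f i))%N) -> Delta lekm L ->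
  \sum_i L i j * mcoeff (mlead (f (widen_ord lekm j))) (f i) != 0 ->
  mpdeg (f (widen_ord lekm j)) = mpdeg (lin_comp_poly L f j).
Proof.
move=> f_decr f_gt0 /DeltaP DL; set w := widen_ord lekm j => coef0.
have msizef i : mpoly.msize (f i) = (mpdeg (f i)).+1.
  by rewrite prednK//; have := f_gt0 i; rewrite /mpdeg; case: (mpoly.msize _).
have fw0 : f w != 0.
  by apply: contraTneq (f_gt0 w) => ->; rewrite /mpdeg msize0.
have le_msize : (mpoly.msize (lin_comp_poly L f j) <= mpoly.msize (f w))%N.
  rewrite /lin_comp_poly; apply: leq_trans (msize_sum _ _ _) _.
  apply/bigmax_leqP => i _; have [ik|ki] := ltnP i k.
    rewrite DL//; have [ij|_] := eqVneq (i : nat) j; last by rewrite scale0r msize0.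
    by rewrite scale1r (_ : i = w)//; apply/val_inj.
  apply: leq_trans (msizeZ_le _ _) _; rewrite !msizef ltnS; apply: f_decr.
  by apply: leq_trans ki; apply: ltnW => /=.
have : mlead (f w) \in msupp (lin_comp_poly L f j).
  rewrite mcoeff_msupp /lin_comp_poly raddf_sum/=.
  by under eq_bigr do rewrite mcoeffZ.
move=> /msize_mdeg_lt; rewrite mlead_deg// => ge_msize.
by congr _.-1; apply/eqP; rewrite eqn_leq ge_msize.
Qed.

End Genericity.

Theorem theorem3p3 (R : realType) (N m k : nat) (n : \bar R)
    (X : set 'rV[R]_N) (F : 'rV[R]_N -> 'rV[R]_m)
    (X_closed : closed X) (X_semialg : semialgebraic X)
    (dimX : semialg_dim X = n)
    (F_cont : {within X, continuous F}) (F_semialg : semialgebraic_map X F)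
    (F_zeros : compact (zeros X F))
    (lenk : (n <= (k%:R)%:E)%E) (lekm : (k <= m)%N) :
  (forall L : 'M[R]_(m, k), compact (zeros X (lin_comp L F)) ->
     (loj_exp_infty X (lin_comp L F) <= loj_exp_infty X F)%E) /\
  generically [set: 'M[R]_(m, k)] (fun L =>
    compact (zeros X (lin_comp L F)) /\
    loj_exp_infty X F = loj_exp_infty X (lin_comp L F)) /\
  generically (Delta lekm) (fun L =>
    loj_exp_infty X F = loj_exp_infty X (lin_comp L F)) /\
  (forall f : 'I_m -> mpoly N R,
     (forall x, X x -> forall i, F x ord0 i = peval (f i) x) ->
     (forall i j : 'I_m, (i <= j)%N -> (mpdeg (f j) <= mpdeg (f i))%N) ->
     (forall i, (0 < mpdeg (f i))%N) ->
     generically (Delta lekm) (fun L =>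
       loj_exp_infty X F = loj_exp_infty X (lin_comp L F) /\
       forall j : 'I_k,
         mpdeg (f (widen_ord lekm j)) = mpdeg (lin_comp_poly L f j))).
Proof.
(* As [dim X <= k < k + 1], the infimum defining [dim X] provides an algebraic set of dimension less
   than [k + 1]. *)
have [V [aV XV dimV]] : exists V, [/\ algebraic V, X `<=` V & ~ irreducible_chain V k.+1].
  have : (semialg_dim X < k.+1%:R%:E)%E.
    by rewrite dimX; apply: le_lt_trans lenk _; rewrite lte_fin ltr_nat.
  move=> /ereal_inf_lt[_ [V [aV XV] <-] Vk]; exists V; split=> // chainV.
  move: Vk; rewrite ltNge => /negP; apply.
  by apply: ereal_sup_ubound; exists k.+1.
have [p [pp [v0 pv0] pbad]] := bad_projection_thin aV XV dimV F_semialg F_zeros.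
have good L : p (mxvec L) != 0 -> ~ bad_projection X F L.
  by apply: contra_neq_not => bad; apply: pbad; rewrite /= mxvecK.
have [A Au qneq0] := Delta_polyfun_neq0 lekm pp (ex_intro _ v0 pv0).
pose q v := p (mxvec (vec_mx v *m A)).
have qp : polyfun q by exact: polyfun_comp pp (polymap_mulmxr A).
(* If [L *m A] is not bad, its lower bound passes to [L], since [|F(x) L A|^2 <= B |F(x) L|^2]. *)
have loj_Delta L : q (mxvec L) != 0 -> loj_exp_infty X F = loj_exp_infty X (lin_comp L F).
  rewrite /q mxvecK => /good/good_projection[e e0 he].
  have [B B0 hB] := sqn_mulmx_le A.
  apply: (@loj_exp_infty_lin_comp _ _ _ _ _ _ _ (B^-1 * e) e); rewrite ?mulr_gt0 ?invr_gt0//.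
  move=> x Xx ex; rewrite -mulrA ler_pdivrMl//.
  apply: le_trans (ltW (he x Xx ex)) _; rewrite mulmxA; exact: hB.
split; first by move=> L _; exact: loj_exp_infty_lin_comp_le.
split.
  apply: (generically_polyfun (f := p)) => //; first by exists v0.
  move=> L _ /good nbad; split; first exact: compact_zeros_lin_comp.
  have [e e0 he] := good_projection nbad.
  by apply: (loj_exp_infty_lin_comp e0 e0) => x Xx ex; apply/ltW/he.
split.
  apply: (generically_polyfun (f := q)) => //; first exact: Delta_line_closed.
  by move=> L _; exact: loj_Delta.
move=> f _ f_decr f_gt0.
(* [h j] is the coefficient, in the j-th component of [L] applied to [f], of the leading monomial of
   the j-th polynomial. *)
pose h (j : 'I_k) (v : 'rV[R]_(m * k)) :=
  \sum_i vec_mx v i j * mcoeff (mlead (f (widen_ord lekm j))) (f i).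
have hp j : polyfun (h j).
  apply: polyfun_sum => i _; apply: polyfunM; last exact: polyfun_cst.
  by apply: (eq_polyfun _ (polyfun_coord (mxvec_index i j))) => v; rewrite mxE.
have hprodp : polyfun (fun v => \prod_j h j v) by apply: polyfun_prod.
have [||v Dv qhv] := polyfun_mul_neq0 (@Delta_line_closed _ _ _ lekm) qp hprodp.
- exact: qneq0.
- apply: polyfun_prod_neq0 => //; first exact: Delta_line_closed.
    by exists (mxvec (pid_mx k)); rewrite /= mxvecK; exact: Delta_pid_mx.
  (* For [pid_mx k] the j-th component is the j-th polynomial itself, so [h j] is its leading
     coefficient. *)
  move=> j _; exists (mxvec (pid_mx k)); first by rewrite /= mxvecK; exact: Delta_pid_mx.
  rewrite /h mxvecK (bigD1 (widen_ord lekm j))//= big1 ?addr0.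
    rewrite mxE /= eqxx ltn_ord mul1r mleadc_eq0.
    by apply: contraTneq (f_gt0 (widen_ord lekm j)) => ->; rewrite /mpdeg msize0.
  move=> i ij; rewrite mxE (_ : (i == j :> nat) = false) ?mul0r//.
  by apply: contraNF ij => /eqP ij; apply/eqP/val_inj.
apply: (generically_polyfun (f := fun v => q v * \prod_j h j v)).
- exact: Delta_line_closed.
- exact: polyfunM.
- by exists v.
move=> L DL; rewrite mulf_eq0 negb_or => /andP[qL /prodf_neq0 hL].
split; first exact: loj_Delta.
move=> j; apply: mpdeg_lin_comp_poly => //.
by have := hL j isT; rewrite /h mxvecK.
Qed.
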